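(* Let $m,n$ be positive integers, and for a positive integer $p$ let $k_p(\bm z,\bm w)=\left(\dfrac{1}{1-\langle \bm z,\bm w\rangle}\right)^p$ for $\bm z,\bm w\in\mathbb{B}_d$. If the kernel $k_m$ admits a characteristic function through the kernel $k_n$, then $n=1$.
   Context: Fix an integer $d\ge1$; $\mathbb{B}_d$ is the open Euclidean unit ball of $\mathbb{C}^d$. A unitarily invariant kernel is a function $k(\bm z,\bm w)=\sum_{n\ge0}a_n^{(k)}\langle \bm z,\bm w\rangle^n$ on $\mathbb{B}_d\times\mathbb{B}_d$ with $a_n^{(k)}>0$ for all $n$ and $a_0^{(k)}=1$; it is always assumed non-vanishing. $H_k$ is its reproducing kernel Hilbert space. Real numbers $b_n^{(k)}$ ($n\ge1$) are defined by $\sum_{n\ge1}b_n^{(k)}\langle \bm z,\bm w\rangle^n=1-1/k(\bm z,\bm w)$. For $\alpha\in\mathbb{Z}_+^d$ put $a_\alpha^{(k)}=a_{|\alpha|}^{(k)}\binom{|\alpha|}{\alpha}$ and, for $\alpha\ne0$, $b_\alpha^{(k)}=b_{|\alpha|}^{(k)}\binom{|\alpha|}{\alpha}$, where $\binom{|\alpha|}{\alpha}=|\alpha|!/(\alpha_1!\cdots\alpha_d!)$. For a Hilbert space $\mathcal E$, $H_k\otimes\mathcal E$ is identified with the space of holomorphic $\mathcal E$-valued functions $\sum c_\alpha \bm z^\alpha$ on $\mathbb{B}_d$ with $\sum\|c_\alpha\|^2\|\bm z^\alpha\|_{H_k}^2<\infty$. A commuting $d$-tuple $T=(T_1,\dots,T_d)$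 of bounded operators on a Hilbert space $\mathcal H$ is a $1/k$-contraction if $\sum_{\alpha\ne0}b_\alpha^{(k)}T^\alpha(T^\alpha)^*$ converges strongly to a contraction; then $\Delta_T=\big(I-\sum_{\alpha\neq 0}b_\alpha^{(k)}T^\alpha(T^\alpha)^*\big)^{1/2}$. It is pure if $\sum_{\alpha\in\mathbb{Z}_+^d}a_\alpha^{(k)}T^\alpha\Delta_T^2(T^\alpha)^*$ converges strongly to $I$. In that case $V_T:\mathcal H\to H_k\otimes\overline{\mathrm{Ran}}\,\Delta_T$, $V_Th=\sum_\alpha a_\alpha^{(k)}\bm z^\alpha\otimes\Delta_T(T^\alpha)^*h$, is an isometry. A unitarily invariant kernel $k$ is admissible if the coordinate multiplication operators $M_{z_i}^{(k)}$ are bounded on $H_k$ and $(M_{z_1}^{(k)},\dots,M_{z_d}^{(k)})$ is a $1/k$-contraction. The kernels $k_p$ are known to be admissible. Let $k,l$ be admissible kernels. A pure $1/k$-contraction $T$ admits a characteristic function through $l$ if there exist a Hilbert space $\mathcal E$ and a $\mathcal B(\mathcal E,\overline{\mathrm{Ran}}\,\Delta_T)$-valued analytic function $\theta_T$ on $\mathbb{B}_d$ such that $M_{\theta_T}$ is a (bounded) multiplication operator from $H_l\otimes\mathcal E$ to $H_k\otimes\overline{\mathrm{Ran}}\,\Delta_T$ satisfying $I-V_TV_T^*=M_{\theta_T}M_{\theta_T}^*$. The kernel $k$ admits a characteristic function through $l$ if every pure $1/k$-contraction does. *)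

(* Defs.v *)
From HB Require Import structures.
From mathcomp Require Import all_boot all_order all_algebra.
From mathcomp Require Import finmap complex.
From mathcomp Require Import all_classical all_reals all_analysis.
From mathcomp.analysis.showcase Require Import summability.

Set Implicit Arguments.
Unset Strict Implicit.
Unset Printing Implicit Defensive.

Import Order.TTheory GRing.Theory Num.Theory.
Import numFieldNormedType.Exports.

Local Open Scope classical_set_scope.
Local Open Scope ring_scope.
Local Open Scope complex_scope.

(* [hdot] is linear in its first argument and conjugate-linear in the second. *)
HB.mixin Record CompleteNormedModule_isHilbert (R : realType) H
    & CompleteNormedModule R[i] H := {
  hdot : {dot H for (Num.conj : R[i] -> R[i])} ;
  hdotE : forall x : H, `|x| ^+ 2 = hdot x x
}.

#[short(type="hilbertType")]
HB.structure Definition Hilbert (R : realType) :=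
  {H of CompleteNormedModule R[i] H & CompleteNormedModule_isHilbert R H}.

Notation "''[' x , y ]" := (hdot x y) : ring_scope.

Definition bounded_operator (R : realType) (H K : hilbertType R) (A : H -> K) :=
  linear A /\ exists M : R[i], forall x, `|A x| <= M * `|x|.

(* The Hilbert space adjoint: for a bounded [A] exactly one [B] satisfies the
   defining property, by the Riesz representation theorem. *)
Definition adjoint (R : realType) (H K : hilbertType R) (A : H -> K) : K -> H :=
  xget (fun=> 0) [set B : K -> H | forall x y, '[A x, y] = '[x, B y]].

Definition positive_operator (R : realType) (H : hilbertType R) (A : H -> H) :=
  bounded_operator A /\ forall x, 0 <= '[A x, x].

(* Every positive operator has exactly one positive square root. *)
Definition sqrt_operator (R : realType) (H : hilbertType R) (A : H -> H) :
    H -> H :=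
  xget (fun=> 0) [set B : H -> H | positive_operator B /\ B \o B =1 A].

Definition mindex (d : nat) := {ffun 'I_d -> nat}.

Section MultiIndex.
Variable d : nat.
Implicit Type al : mindex d.

Definition mdegree al : nat := (\sum_i al i)%N.

Definition multinomial al : nat := ((mdegree al)`! %/ \prod_i (al i)`!)%N.

End MultiIndex.

Definition uball (R : realType) (d : nat) :=
  {z : 'rV[R[i]]_d | \sum_i `|z 0 i| ^+ 2 < 1}.

Section Ball.
Variables (R : realType) (d : nat).
Implicit Types (z w : uball R d) (al : mindex d).

Definition cinner z w : R[i] := \sum_i sval z 0 i * (sval w 0 i)^*.

Definition monomial al z : R[i] := \prod_i sval z 0 i ^+ al i.

End Ball.

Definition kernel (R : realType) (d : nat) := uball R d -> uball R d -> R[i].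

Section Kernel.
Variables (R : realType) (d : nat) (k : kernel R d).

(* For [d >= 1] the values of [cinner] fill the open unit disc, so that the
   sequences below are determined by [k] as soon as they exist (except for the
   term of index 0 of [kernel_b], which is never used). *)
Definition kernel_a : nat -> R :=
  xget (fun=> 0) [set a : nat -> R | forall z w,
    (fun N => \sum_(0 <= n < N) (a n)%:C * cinner z w ^+ n : R[i]^o)
      @ \oo --> (k z w : R[i]^o)].

Definition kernel_b : nat -> R :=
  xget (fun=> 0) [set b : nat -> R | forall z w,
    (fun N => \sum_(1 <= n < N) (b n)%:C * cinner z w ^+ n : R[i]^o)
      @ \oo --> (1 - (k z w)^-1 : R[i]^o)].

Definition kernel_ma (al : mindex d) : R[i] :=
  (kernel_a (mdegree al) *+ multinomial al)%:C.

(* Extended by 0 to [al = 0], so that sums over [al != 0] can be written as sums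
   over all multi-indices. *)
Definition kernel_mb (al : mindex d) : R[i] :=
  if mdegree al == 0%N then 0 else (kernel_b (mdegree al) *+ multinomial al)%:C.

(* The reproducing kernel Hilbert space of [k], as a Hilbert space whose elements
   are identified by [rkhs_fun] with functions on the ball. By the
   Moore-Aronszajn theorem it exists for every positive definite [k], and as a
   Hilbert space of functions it is unique. Linearity of [rkhs_fun] follows from
   [rkhs_reproducing]. *)
Record rkhs := Rkhs {
  rkhs_space :> hilbertType R ;
  rkhs_fun : rkhs_space -> uball R d -> R[i] ;
  rkhs_fun_inj : injective rkhs_fun ;
  rkhs_reproducing : forall w, exists kw : rkhs_space,
    rkhs_fun kw = k^~ w /\ forall f, rkhs_fun f w = '[f, kw]
}.

Definition monomial_normsq (Hk : rkhs) (al : mindex d) : R[i] :=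
  `|xget 0 [set f : Hk | rkhs_fun f = monomial al]| ^+ 2.

End Kernel.

(* Elements are represented by their coefficient families [c], standing for the
   function z |-> \sum_al z ^ al c_al on the ball. For the tensor product of [Hk]
   with a closed subspace [D] of [E], all the coefficients lie in [D].
   Sums over multi-indices are unordered sums, i.e. limits of the finite partial
   sums along the filter [totally]. *)
Section Tensor.
Variables (R : realType) (d : nat) (k : kernel R d) (Hk : rkhs k).
Variable E : hilbertType R.
Implicit Types (c : mindex d -> E) (D : set E).

Definition tensor_space D : set (mindex d -> E) :=
  [set c | (forall al, D (c al)) /\
    cvg (partial_sum (fun al => monomial_normsq Hk al * `|c al| ^+ 2 : R[i]^o)
      @ totally)].

Definition tensor_dot c c' : R[i] :=
  sum (fun al => monomial_normsq Hk al * '[c al, c' al] : R[i]^o).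

Definition tensor_norm c : R[i] := sqrtC (tensor_dot c c).

Definition tensor_fun c (z : uball R d) : E :=
  sum (fun al => monomial al z *: c al).

End Tensor.

Section Contraction.
Variables (R : realType) (d : nat) (k : kernel R d) (H : hilbertType R).
Variable T : 'I_d -> H -> H.

Definition commuting_tuple :=
  (forall i, bounded_operator (T i)) /\ forall i j, T i \o T j =1 T j \o T i.

Definition tuple_pow (al : mindex d) : H -> H :=
  \big[comp/id]_(i < d) iter (al i) (T i).

Definition tuple_pow_adj (al : mindex d) : H -> H := adjoint (tuple_pow al).

Definition b_summand (h : H) (al : mindex d) : H :=
  kernel_mb k al *: tuple_pow al (tuple_pow_adj al h).

Definition is_contraction :=
  [/\ commuting_tuple,
      forall h, cvg (partial_sum (b_summand h) @ totally) &
      forall h, `|sum (b_summand h)| <= `|h| ].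

Definition defect : H -> H := sqrt_operator (fun h => h - sum (b_summand h)).

Definition defect_space : set H := closure (range defect).

Definition is_pure := forall h : H,
  partial_sum (fun al => kernel_ma k al *:
      tuple_pow al (defect (defect (tuple_pow_adj al h)))) @ totally --> h.

(* The coefficient family of V_T h. *)
Definition V_map (h : H) (al : mindex d) : H :=
  kernel_ma k al *: defect (tuple_pow_adj al h).

End Contraction.

Section CharacteristicFunction.
Variables (R : realType) (d : nat) (k l : kernel R d).
Variables (Hk : rkhs k) (Hl : rkhs l).

Definition operator_into (E H : hilbertType R) (D : set H) (A : E -> H) :=
  bounded_operator A /\ forall x, D (A x).

(* A B(E, D)-valued analytic function on the ball: the sum of a power series
   converging in operator norm. *)
Definition analytic_operator (E H : hilbertType R) (D : set H)
    (theta : uball R d -> E -> H) :=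
  (forall z, operator_into D (theta z)) /\
  exists2 Theta : mindex d -> E -> H,
    forall al, operator_into D (Theta al) &
    forall z (e : R[i]), 0 < e -> \forall J \near totally, forall x,
      `|theta z x - partial_sum (fun al => monomial al z *: Theta al x) J|
        <= e * `|x|.

(* [M] is the multiplication operator M_theta, from the tensor product of [Hl]
   with [E] to that of [Hk] with [D]. *)
Definition multiplication_operator (E H : hilbertType R) (D : set H)
    (theta : uball R d -> E -> H) (M : (mindex d -> E) -> mindex d -> H) :=
  (forall f, tensor_space Hl setT f -> tensor_space Hk D (M f) /\
     forall z, tensor_fun (M f) z = theta z (tensor_fun f z)) /\
  exists C : R[i], forall f, tensor_space Hl setT f ->
     tensor_norm Hk (M f) <= C * tensor_norm Hl f.

(* [Ms] and [Vs] are the adjoints of M_theta and V_T, which exist and are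
   unique, both operators being bounded. *)
Definition admits_char_fun (H : hilbertType R) (T : 'I_d -> H -> H) :=
  let D := defect_space k T in
  exists (E : hilbertType R) (theta : uball R d -> E -> H)
    (M : (mindex d -> E) -> mindex d -> H)
    (Ms : (mindex d -> H) -> mindex d -> E) (Vs : (mindex d -> H) -> H),
  [/\ analytic_operator D theta,
      multiplication_operator D theta M,
      forall g, tensor_space Hk D g -> tensor_space Hl setT (Ms g) /\
        forall f, tensor_space Hl setT f ->
          tensor_dot Hk (M f) g = tensor_dot Hl f (Ms g),
      forall g, tensor_space Hk D g ->
        forall h, tensor_dot Hk (V_map k T h) g = '[h, Vs g] &
      forall g, tensor_space Hk D g ->
        forall al, g al - V_map k T (Vs g) al = M (Ms g) al].

Definition kernel_admits_char_fun :=
  forall (H : hilbertType R) (T : 'I_d -> H -> H),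
    is_contraction k T -> is_pure k T -> admits_char_fun T.

End CharacteristicFunction.

Definition kernel_pow (R : realType) (d p : nat) : kernel R d :=
  fun z w => (1 / (1 - cinner z w)) ^+ p.

(* Main.v *)
Require Import Defs.
From mathcomp Require Import all_boot all_order all_algebra.
From mathcomp Require Import all_classical all_reals all_analysis.
From mathcomp Require Import finmap complex sesquilinear ring.
From mathcomp.analysis.showcase Require Import summability.

(** Write [a_j] for the Taylor coefficients of the kernel of exponent [m] and
    [w_j = 1 / a_j] for the squared norm of the power [z_1 ^ j] in its space. The
    idea is to test the hypothesis on one operator tuple for which [I - V V*] is
    explicit, and to compare norms in two consecutive degrees.

    The tuple is [(T_1, 0, ..., 0)], where [T_1] compresses multiplication by
    [z_1] to the span of [1, z_1, ..., z_1 ^ N] and vanishes on the orthogonal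
    complement ([shift]). The convolution identity between the coefficients of
    the kernel and those of its reciprocal shows that the sum of the
    [b_al T^al (T^al)*] is the projection onto the span of [z_1, ..., z_1 ^ N]
    ([cvg_b_summand]); hence the tuple is a pure contraction, its defect operator
    is the complementary projection, and on the vectors [G_j = z_1 ^ j (x) 1] the
    operator [I - V V*] is 0 for [j <= N] and the identity for [j > N].

    Suppose that [I - V V* = M M*] for a multiplication operator [M] from the
    space of exponent [n], and put [F_j = M* G_j]. Since [M] multiplies functions,
    the coefficients of the [F_j] are linked: testing on [M (z^be e)] moves the
    index of [F_j] down by [be], and gives 0 if [be] is off the first axis
    ([tensor_fun_axis_shift]). As [F_j = 0] for [j <= N], the vector [F_(N+1)]
    reduces to its constant coefficient, of squared norm [w_(N+1)], and the
    coefficient of [z_1] in [F_(N+2)] is [n w_(N+2) / w_(N+1)] times that vector,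
    because [z_1] has squared norm [1 / n] in the source space. The squared norm
    [w_(N+2)] of [F_(N+2)] is at least that of this single term, which amounts to
    [n a_(N+1) <= a_(N+2)]. But [a_(N+2) / a_(N+1)] tends to 1 and is already
    below 2 for [N = m] ([pow_coef_ratio]), so [n = 1].

    Two analytic inputs support this. The powers of [z_1] and their norms must be
    found in a space known only through its reproducing kernel; they arise as
    limits of divided differences of kernel functions ([gram_of_monomialsS]). And
    equalities of functions on the ball must be turned into equalities of
    coefficients; restricting to the first axis makes this a statement about
    power series in one variable ([power_series_uniq]). *)

Set Implicit Arguments.
Unset Strict Implicit.
Unset Printing Implicit Defensive.

Import Order.TTheory GRing.Theory Num.Theory.
Import numFieldNormedType.Exports.

Local Open Scope classical_set_scope.
Local Open Scope ring_scope.

#[local] Existing Instance totally_filter.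

(** * Inner products *)
Section Hilbert.
Variables (R : realType) (H : hilbertType R).
Implicit Types x y z : H.

Lemma hdotC x y : '[x, y] = '[y, x]^*.
Proof. by rewrite hermC expr0 mul1r. Qed.

Lemma hdotZl (a : R[i]) x y : '[a *: x, y] = a * '[x, y].
Proof. by rewrite linearZl_LR. Qed.

Lemma hdotZr (a : R[i]) x y : '[x, a *: y] = a^* * '[x, y].
Proof. by rewrite linearZr_LR. Qed.

Lemma hdot_eq0 x : '[x, x] = 0 -> x = 0.
Proof. by rewrite -hdotE => /eqP; rewrite sqrf_eq0 normr_eq0 => /eqP. Qed.

Lemma hdotr_inj x y : (forall z, '[z, x] = '[z, y]) -> x = y.
Proof.
move=> xy; apply/eqP; rewrite -subr_eq0; apply/eqP/hdot_eq0.
by rewrite linearBr /= xy subrr.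
Qed.

Lemma hdot_suml I (r : seq I) (P : pred I) (F : I -> H) y :
  '[\sum_(i <- r | P i) F i, y] = \sum_(i <- r | P i) '[F i, y].
Proof. by elim/big_rec2: _ => [|i a b _ <-]; rewrite ?linear0l ?linearDl. Qed.

Lemma hdot_sumr I (r : seq I) (P : pred I) (F : I -> H) y :
  '[y, \sum_(i <- r | P i) F i] = \sum_(i <- r | P i) '[y, F i].
Proof. by elim/big_rec2: _ => [|i a b _ <-]; rewrite ?linear0r ?linearDr. Qed.

Lemma hilbert_cauchy_schwarz x y : `|'[x, y]| <= `|x| * `|y|.
Proof.
have [->|y0] := eqVneq y 0; first by rewrite linear0r !normr0 mulr0.
have yn0 : `|y| != 0 by rewrite normr_eq0.
have y2 : '[y, y] != 0 by rewrite -hdotE sqrf_eq0.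
have: 0 <= '[x - ('[x, y] / '[y, y]) *: y, x - ('[x, y] / '[y, y]) *: y].
  by rewrite -hdotE exprn_ge0.
rewrite linearBl /= !linearBr /= !hdotZl !hdotZr mulrA.
have -> : '[x, y] / '[y, y] * ('[x, y] / '[y, y])^* * '[y, y]
   = ('[x, y] / '[y, y])^* * '[x, y] by rewrite mulrAC divfK// mulrC.
rewrite opprB addrA subrK -!hdotE subr_ge0 (hdotC y x) => h.
have : '[x, y] * '[x, y]^* <= `|x| ^+ 2 * `|y| ^+ 2.
  rewrite -ler_pdivrMr ?exprn_gt0 ?normr_gt0//.
  by apply: le_trans h; rewrite le_eqVlt; apply/orP; left; apply/eqP; ring.
by rewrite -normCK -exprMn ler_sqr ?nnegrE ?mulr_ge0.
Qed.

Lemma cvg_hdotl (T : Type) (F : set_system T) {FF : Filter F} (f : T -> H) l y :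
  f @ F --> l -> (fun a => '[f a, y] : R[i]^o) @ F --> ('[l, y] : R[i]^o).
Proof.
move=> fl; apply/cvgrPdist_le => e e0.
have /cvgrPdist_le/(_ (e / (`|y| + 1))) := fl.
have y1 : 0 < `|y| + 1 by rewrite ltr_wpDl.
move=> /(_ (divr_gt0 e0 y1)); apply: filterS => a h.
rewrite -linearBl /=; apply: le_trans (hilbert_cauchy_schwarz _ _) _.
apply: le_trans (ler_wpM2r (normr_ge0 y) h) _.
by rewrite mulrAC ler_pdivrMr// ler_wpM2l ?(ltW e0)// lerDl.
Qed.

End Hilbert.

(** * Limits and order in R[i] *)
Section ComplexOrder.
Variable R : realType.

Lemma real_complexRe (x : R[i]) : 0 <= x -> x = (complex.Re x)%:C%C.
Proof. by case: x => a b; rewrite lecE /= => /andP[/eqP -> _]. Qed.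

(** Only the real axis of [R[i]] is ordered: bounds between zero and one force
    [x] and [e] to be real, and the claim becomes one about [R]. *)
Lemma powers_small (x e : R[i]) : 0 <= x < 1 -> 0 < e ->
  \forall n \near \oo, x ^+ n <= e.
Proof.
move=> /andP[x0 x1] e0; rewrite (real_complexRe x0) (real_complexRe (ltW e0)).
have {x1} x1 : complex.Re x < 1 by rewrite -ltcR -real_complexRe.
have {x0} x0 : 0 <= complex.Re x by rewrite -lecR -real_complexRe.
have {e0} e0 : 0 < complex.Re e by rewrite -ltcR -real_complexRe// ltW.
have : (fun n => 1 * (complex.Re x) ^+ n) @ \oo --> (0:R).
  by apply: cvg_geometric; rewrite ger0_norm.
move=> /cvgrPdist_le /(_ _ e0); apply: filterS => n.
by rewrite mul1r sub0r normrN ger0_norm ?exprn_ge0// -rmorphXn /= lecR.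
Qed.

Lemma half_powers_small (e : R[i]) : 0 < e -> \forall n \near \oo, 2^-1 ^+ n <= e.
Proof. by apply: powers_small; rewrite invr_ge0 ler0n/= invf_lt1 ?ltr1n. Qed.

Lemma complex_cvg_unique (T : Type) (F : set_system T) {FF : ProperFilter F}
    (f : T -> R[i]) (x y : R[i]) :
  (f : T -> R[i]^o) @ F --> (x : R[i]^o) ->
  (f : T -> R[i]^o) @ F --> (y : R[i]^o) -> x = y.
Proof. by move=> fx fy; exact: (cvg_unique (@norm_hausdorff _ R[i]^o) fx fy). Qed.

(** An element is nonnegative exactly when it equals its norm, which is a closed
    condition. *)
Lemma complex_lim_ge0 (T : Type) (F : set_system T) {FF : ProperFilter F}
    (f : T -> R[i]) (x : R[i]) :
  (f : T -> R[i]^o) @ F --> (x : R[i]^o) -> (\forall a \near F, 0 <= f a) -> 0 <= x.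
Proof.
move=> fx f0; suff -> : x = `|x| by [].
apply/eqP; rewrite -subr_eq0 -normr_eq0 eq_le normr_ge0 andbT.
apply/ler_addgt0Pr => e e0; rewrite add0r.
have /cvgrPdist_le/(_ _ (divr_gt0 e0 (ltr0n _ 2))) h := fx.
have [a [h1 h2]] := filter_ex (filterI h f0).
have -> : x - `|x| = (x - f a) + (`|f a| - `|x|) by rewrite (ger0_norm h2) subrKA.
apply: le_trans (ler_normD _ _) _; rewrite [e]splitr lerD//.
by apply: le_trans (ler_dist_dist _ _) _; rewrite distrC.
Qed.

End ComplexOrder.

(** * Vector-valued power series in one variable *)
Section PowerSeries.
Variables (R : realType) (V : normedModType R[i]).

Lemma le_normB_lim (T : Type) (F : set_system T) {FF : ProperFilter F}
    (f : T -> V) (l c : V) (B : R[i]) :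
  f @ F --> l -> (\forall a \near F, `|f a - c| <= B) -> `|l - c| <= B.
Proof.
move=> fl fB; apply/ler_addgt0Pr => e e0.
have /cvgrPdist_le/(_ e e0) h := fl.
have [a [h1 h2]] := filter_ex (filterI h fB).
rewrite [B + e]addrC; apply: le_trans (lerD h1 h2).
by apply: le_trans (ler_normD _ _); rewrite addrA subrK.
Qed.

Lemma geometric_tail (u : nat -> V) (K : R[i]) :
  (forall j, `|u j| <= K * 2^-1 ^+ j) ->
  forall m n, `|\sum_(m <= j < n) u j| <= K * 2 * 2^-1 ^+ m.
Proof.
move=> uK m n; have K0 : 0 <= K by have := uK 0%N; rewrite mulr1; exact: le_trans.
have [nm|mn] := leqP n m.
  by rewrite big_geq// normr0 !mulr_ge0 ?exprn_ge0 ?invr_ge0.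
have : `|\sum_(m <= j < n) u j| <= K * 2 * (2^-1 ^+ m - 2^-1 ^+ n).
  elim: n mn => // n ih; rewrite ltnS leq_eqVlt => /predU1P[<-|mn].
    rewrite big_nat1 exprS; apply: le_trans (uK _) _.
    by rewrite le_eqVlt; apply/orP; left; apply/eqP; field.
  rewrite big_nat_recr/= ?(ltnW mn)//; apply: le_trans (ler_normD _ _) _.
  apply: le_trans (lerD (ih mn) (uK n)) _.
  by rewrite le_eqVlt; apply/orP; left; apply/eqP; rewrite exprS; field.
move/le_trans; apply; apply: ler_wpM2l; first by rewrite mulr_ge0.
by rewrite lerBlDr lerDl exprn_ge0 ?invr_ge0.
Qed.

Lemma cvg_series_terms_bounded (u : nat -> V) (l : V) :
  (fun N => \sum_(0 <= j < N) u j) @ \oo --> l ->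
  exists2 K : R[i], 0 <= K & forall j, `|u j| <= K.
Proof.
move=> ul; have /cvgrPdist_le/(_ 1 ltr01) [N _ hN] := ul.
exists (2 + \sum_(0 <= j < N) `|u j|).
  by rewrite addr_ge0 ?sumr_ge0.
move=> j; have [jN|Nj] := ltnP j N.
  rewrite (big_nat_widen _ _ _ _ _ (leqnn _)) big_mkord.
  rewrite (bigD1 (Ordinal jN))//= addrCA lerDl addr_ge0// sumr_ge0//.
have -> : u j = (l - \sum_(0 <= i < j) u i) - (l - \sum_(0 <= i < j.+1) u i).
  by rewrite big_nat_recr//= opprB [RHS]addrC subrKA [_ + u j]addrC addrK.
apply: le_trans (ler_normB _ _) _.
apply: (@le_trans _ _ (1 + 1)); last by rewrite -[1+1]/(2%:R) lerDl sumr_ge0.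
by apply: lerD; apply: hN => //=; rewrite ltnW.
Qed.

Variables (r : R[i]) (r0 : 0 < r).
Implicit Types (c : nat -> V) (S : R[i] -> V).

(** The origin is excluded so that dividing [c] and [S] by [t], once [c 0] is
    known to vanish, stays within the definition. *)
Definition power_series_on c S := forall t : R[i], t != 0 -> `|t| <= r ->
  (fun N => \sum_(0 <= j < N) t ^+ j *: c j) @ \oo --> S t.

(** Convergence at [r] bounds the terms there, so at half that radius the terms
    after the first one are dominated by a geometric series that carries a factor
    [`|t|]. *)
Lemma power_series_near0 c S : power_series_on c S ->
  exists2 C : R[i], 0 <= C &
    forall t, t != 0 -> `|t| <= r / 2 -> `|S t - c 0%N| <= C * `|t|.
Proof.
move=> cS; have rr : `|r| <= r by rewrite gtr0_norm.
have /cvg_series_terms_bounded [K K0 hK] := cS r (lt0r_neq0 r0) rr.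
exists (K * 2 / r); first by rewrite divr_ge0 ?mulr_ge0// ltW.
move=> t tn0 tr.
have hr : r / 2 <= r by rewrite ler_pdivrMr// ler_peMr ?ler1n// ltW.
apply: (le_normB_lim (cS t tn0 (le_trans tr hr))).
near=> N; have N0 : (0 < N)%N by near: N; exists 1%N.
rewrite big_ltn// expr0 scale1r addrC addKr big_add1.
have -> : K * 2 / r * `|t| = (K * `|t| / r) * 2 * 2^-1 ^+ 0%N.
  by rewrite expr0 mulr1; field; rewrite gt_eqF.
apply: geometric_tail => j; rewrite normrZ normrX.
have := hK j.+1; rewrite normrZ normrX gtr0_norm// => h.
have -> : `|t| ^+ j.+1 * `|c j.+1| =
    (r ^+ j.+1 * `|c j.+1|) * (`|t| / r * (`|t| / r) ^+ j).
  by rewrite -exprS expr_div_n; field; rewrite expf_neq0 ?lt0r_neq0.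
have -> : K * `|t| / r * 2^-1 ^+ j = K * (`|t| / r * 2^-1 ^+ j) by rewrite !mulrA.
have tr0 : 0 <= `|t| / r by rewrite divr_ge0// ltW.
apply: ler_pM => //.
- by rewrite mulr_ge0// exprn_ge0// ltW.
- by rewrite mulr_ge0// exprn_ge0.
rewrite ler_wpM2l//; apply: lerXn2r; rewrite ?nnegrE ?invr_ge0//.
by rewrite ler_pdivrMr// mulrC.
Unshelve. all: by end_near. Qed.

Lemma power_series_const0 c : power_series_on c (fun=> 0) -> c 0%N = 0.
Proof.
move=> /power_series_near0 [C C0 h]; apply/eqP; rewrite -normr_eq0 eq_le normr_ge0 andbT.
apply/ler_addgt0Pr => e e0; rewrite add0r.
have C1 : 0 < C * r + e by rewrite ltr_wpDl// mulr_ge0// ltW.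
have t0 : 0 < r / 2 * (e / (C * r + e)).
  by rewrite !mulr_gt0 ?invr_gt0.
have := h (r / 2 * (e / (C * r + e))) (lt0r_neq0 t0).
rewrite sub0r normrN gtr0_norm// => /(_ _)/le_trans; apply.
  by rewrite ler_piMr ?divr_ge0 ?(ltW r0)// ler_pdivrMr// mul1r lerDr mulr_ge0// ltW.
have -> : C * (r / 2 * (e / (C * r + e))) = e * (C * r / ((C * r + e) * 2)).
  by rewrite invfM; ring.
rewrite ler_piMr ?(ltW e0)// ler_pdivrMr ?mulr_gt0// mul1r mulr_natr mulr2n -addrA lerDl.
by rewrite addr_ge0 ?(ltW e0) ?(ltW C1).
Qed.

(** The constant coefficient vanishes by letting [t] tend to 0; the other ones
    follow by dividing the series by [t]. *)
Lemma power_series_eq0 c : power_series_on c (fun=> 0) -> forall j, c j = 0.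
Proof.
move=> cS j; elim: j c cS => [|j ih] c cS; first exact: power_series_const0.
apply: (ih (fun j => c j.+1)) => t t0 tr.
have c0 := power_series_const0 cS.
have -> : (fun N => \sum_(0 <= j0 < N) t ^+ j0 *: c j0.+1) =
    (fun N => t^-1 *: \sum_(0 <= j0 < N.+1) t ^+ j0 *: c j0).
  apply/funext => N; rewrite [in RHS]big_ltn// c0 scaler0 add0r big_add1 scaler_sumr.
  by apply: eq_bigr => i _; rewrite scalerA exprS mulKf.
have := cS t t0 tr; rewrite -cvg_shiftS => h.
by have := @cvgZl_tmp _ _ _ _ _ t^-1 _ _ h; rewrite scaler0 => {}h; exact: h.
Qed.

Lemma power_series_uniq c c' S :
  power_series_on c S -> power_series_on c' S -> c =1 c'.
Proof.
move=> cS c'S j; apply/eqP; rewrite -subr_eq0; apply/eqP; move: j.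
apply: (@power_series_eq0 (fun j => c j - c' j)) => t t0 tr.
have -> : (fun N => \sum_(0 <= j < N) t ^+ j *: (c j - c' j)) =
    (fun N => \sum_(0 <= j < N) t ^+ j *: c j - \sum_(0 <= j < N) t ^+ j *: c' j).
  by apply/funext => N; rewrite -sumrB; apply: eq_bigr => j _; rewrite scalerBr.
by have := cvgB (cS t t0 tr) (c'S t t0 tr); rewrite subrr; exact.
Qed.

Lemma power_series_shift c c' S :
  power_series_on c S -> power_series_on c' (fun t => t *: S t) ->
  forall j, c' j = if j is j'.+1 then c j' else 0.
Proof.
move=> cS c'S; apply: (power_series_uniq c'S) => t t0 tr.
rewrite -(cvg_shiftS (fun N => \sum_(0 <= j < N) t ^+ j *: (if j is j'.+1 then c j' else 0))).
have -> : (fun N => \sum_(0 <= j < N.+1) t ^+ j *: (if j is j'.+1 then c j' else 0))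
    = (fun N => t *: \sum_(0 <= j < N) t ^+ j *: c j).
  apply/funext => N; rewrite [in LHS]big_ltn// scaler0 add0r big_add1 scaler_sumr.
  by apply: eq_bigr => i _; rewrite scalerA exprS.
by apply: cvgZl_tmp; exact: cS.
Qed.

End PowerSeries.

(** * The binomial series of a negative power *)
Section NegativeBinomial.

(** Pascal's rule makes multiplication by [1 - t] telescope: it lowers the
    exponent of the binomial series by one, up to a boundary term. *)
Lemma mul_oneB_bin (A : comNzRingType) q (t : A) N :
  (1 - t) * \sum_(0 <= j < N) 'C(j + q.+1, q.+1)%:R * t ^+ j =
  \sum_(0 <= j < N) 'C(j + q, q)%:R * t ^+ j - 'C(N + q, q.+1)%:R * t ^+ N.
Proof.
elim: N => [|N ih]; first by rewrite !big_geq// bin_small// mul0r subr0 mulr0.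
rewrite !big_nat_recr//= mulrDr ih addnS addSn binS natrD exprS; ring.
Qed.

Variable R : realType.
Implicit Types (t x : R[i]).

(** For nonnegative [x] the boundary term of [mul_oneB_bin] can be dropped. *)
Lemma sum_bin_le q x N : 0 <= x < 1 ->
  \sum_(0 <= j < N) 'C(j + q, q)%:R * x ^+ j <= (1 / (1 - x)) ^+ q.+1.
Proof.
move=> /andP[x0 x1]; have x1' : 0 < 1 - x by rewrite subr_gt0.
elim: q => [|q ih].
  rewrite expr1 ler_pdivlMr// mulrC.
  have -> : (1 - x) * \sum_(0 <= j < N) 'C(j + 0, 0)%:R * x ^+ j = 1 - x ^+ N.
    elim: N => [|N ihN]; first by rewrite big_geq// mulr0 expr0 subrr.
    by rewrite big_nat_recr//= mulrDr ihN bin0 exprS; ring.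
  by rewrite lerBlDr lerDl exprn_ge0.
rewrite exprS div1r mulrC ler_pdivlMr// mulrC mul_oneB_bin -div1r.
by apply: le_trans ih; rewrite lerBlDr lerDl mulr_ge0 ?exprn_ge0.
Qed.

(** The terms stay bounded at the radius [x] halfway between [`|t|] and 1, hence
    decay like the powers of [`|t| / x]. *)
Lemma bin_powers_cvg0 q t : `|t| < 1 ->
  (fun N => 'C(N + q, q)%:R * t ^+ N : R[i]^o) @ \oo --> (0 : R[i]^o).
Proof.
move=> t1; pose x : R[i] := (1 + `|t|) / 2.
have x1 : x < 1 by rewrite /x ltr_pdivrMr// mul1r ltrD2l.
have tx : `|t| < x by rewrite /x ltr_pdivlMr// mulr_natr mulr2n ltrD2r.
have x0 : 0 < x by apply: le_lt_trans tx.
clearbody x.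
pose K : R[i] := (1 / (1 - x)) ^+ q.+1 + 1.
have K0 : 0 < K.
  by rewrite ltr_wpDl// exprn_ge0// divr_ge0// subr_ge0 ltW.
have hK N : 'C(N + q, q)%:R * x ^+ N <= K.
  have := @sum_bin_le q x N.+1; rewrite x1 (ltW x0) => /(_ isT) h.
  rewrite /K; apply: (@le_trans _ _ ((1 / (1 - x)) ^+ q.+1)); last by rewrite lerDl.
  apply: le_trans h; rewrite big_nat_recr//= lerDr.
  by apply: sumr_ge0 => i _; rewrite mulr_ge0// exprn_ge0// ltW.
apply/cvgrPdist_le => e e0.
have tx01 : 0 <= `|t| / x < 1.
  by rewrite divr_ge0 ?(ltW x0)//= ltr_pdivrMr// mul1r.
have := powers_small tx01 (divr_gt0 e0 K0); apply: filterS => N h.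
rewrite sub0r normrN normrM normrX normr_nat.
have -> : 'C(N + q, q)%:R * `|t| ^+ N = ('C(N + q, q)%:R * x ^+ N) * (`|t| / x) ^+ N.
  have xN : x ^+ N != 0 by rewrite expf_neq0// lt0r_neq0.
  by rewrite expr_div_n; move: xN; move: (x ^+ N) (`|t| ^+ N) => X T X0; field.
have -> : e = K * (e / K) by field; rewrite lt0r_neq0.
apply: ler_pM => //; first by rewrite mulr_ge0// exprn_ge0// ltW.
by rewrite exprn_ge0//; case/andP: tx01.
Qed.

Lemma sum_bin_cvg q t : `|t| < 1 ->
  (fun N => \sum_(0 <= j < N) 'C(j + q, q)%:R * t ^+ j : R[i]^o) @ \oo -->
  ((1 / (1 - t)) ^+ q.+1 : R[i]^o).
Proof.
move=> t1; have t1' : 1 - t != 0.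
  by rewrite subr_eq0; apply: contraTneq t1 => <-; rewrite normr1 ltxx.
elim: q => [|q ih].
  have -> : (fun N => \sum_(0 <= j < N) 'C(j + 0, 0)%:R * t ^+ j : R[i]^o) =
      (fun N => (1 - t)^-1 - (1 - t)^-1 * ('C(N + 0, 0)%:R * t ^+ N)).
    apply/funext => N; elim: N => [|N ihN].
      by rewrite big_geq// bin0 expr0 !mulr1 subrr.
    by rewrite big_nat_recr//= ihN !bin0 exprS; field.
  have h : (fun N => (1 - t)^-1 * ('C(N + 0, 0)%:R * t ^+ N) : R[i]^o) @ \oo -->
      ((1 - t)^-1 * 0 : R[i]^o).
    by apply: cvgM; [exact: cvg_cst | exact: bin_powers_cvg0].
  have := cvgB (cvg_cst ((1 - t)^-1 : R[i]^o)) h.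
  by rewrite mulr0 subr0 expr1 div1r; apply.
have -> : (fun N => \sum_(0 <= j < N) 'C(j + q.+1, q.+1)%:R * t ^+ j : R[i]^o) =
    (fun N => (1 - t)^-1 * (\sum_(0 <= j < N) 'C(j + q, q)%:R * t ^+ j
        - ('C(N + q.+1, q.+1)%:R * t ^+ N - 'C(N + q, q)%:R * t ^+ N))).
  apply/funext => N; rewrite addnS binS natrD mulrDl addrK.
  by rewrite -mul_oneB_bin mulKf.
have := cvgB ih (cvgB (bin_powers_cvg0 q.+1 t1) (bin_powers_cvg0 q t1)).
rewrite !subr0 => h.
have : (fun N => (1 - t)^-1 * (\sum_(0 <= j < N) 'C(j + q, q)%:R * t ^+ j
        - ('C(N + q.+1, q.+1)%:R * t ^+ N - 'C(N + q, q)%:R * t ^+ N)) : R[i]^o) @ \oo -->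
      ((1 - t)^-1 * (1 / (1 - t)) ^+ q.+1 : R[i]^o).
  by apply: cvgM; [exact: cvg_cst | exact: h].
have -> : (1 / (1 - t)) ^+ q.+2 = (1 - t)^-1 * (1 / (1 - t)) ^+ q.+1.
  by rewrite exprS div1r.
exact.
Qed.

(** This says that [(1 - 'X) ^+ q.+1] is inverse to the binomial series; the
    series is truncated to a polynomial, which changes no coefficient up to
    degree [l]. *)
Lemma oneB_exp_convolution (A : comNzRingType) q l :
  \sum_(i < l.+1) ((1 - 'X) ^+ q.+1 : {poly A})`_i * 'C(l - i + q, q)%:R
    = (l == 0%N)%:R.
Proof.
pose P q := \poly_(j < l.+1) ('C(j + q, q)%:R : A).
have agree (B C D : {poly A}) : (forall i, (i <= l)%N -> B`_i = C`_i) ->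
    forall i, (i <= l)%N -> (D * B)`_i = (D * C)`_i.
  move=> BC i il; rewrite !coefM; apply: eq_bigr => j _; rewrite BC//.
  exact: leq_trans (leq_subr _ _) il.
have step q' i : (i <= l)%N -> ((1 - 'X) * P q'.+1)`_i = (P q')`_i.
  move=> il; rewrite mulrBl mul1r coefB coefXM !coef_poly ltnS il.
  case: i il => [|i il] /=; first by rewrite !add0n !binn subr0.
  by rewrite ltnS (ltnW il) addSn binS natrD [_ + 'C(_, q')%:R]addrC addrK addSnnS.
have step0 i : (i <= l)%N -> ((1 - 'X) * P 0%N)`_i = (i == 0%N)%:R.
  move=> il; rewrite mulrBl mul1r coefB coefXM !coef_poly ltnS il.
  case: i il => [|i il] /=; first by rewrite !bin0 subr0.
  by rewrite ltnS (ltnW il) !bin0 subrr.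
have key : forall q' i, (i <= l)%N -> ((1 - 'X) ^+ q'.+1 * P q')`_i = (i == 0%N)%:R.
  elim=> [|q' ih] i il; first by rewrite expr1 step0.
  by rewrite exprSr -mulrA (agree _ (P q')) ?ih// => j jl; rewrite step.
rewrite -(key q l)// coefM; apply: eq_bigr => i _.
by rewrite coef_poly ltnS leq_subr.
Qed.

End NegativeBinomial.

(** * Taylor coefficients of the kernels *)
Section KernelCoefficients.
Variables (R : realType) (d : nat).
Implicit Types (z w : uball R d.+1) (t : R[i]).

Lemma axis_point_subproof t : `|t| < 1 ->
  \sum_i `|(\row_(i < d.+1) (if i == ord0 then t else 0)) 0 i| ^+ 2 < 1.
Proof.
move=> t1; rewrite big_ord_recl big1 => [|i _]; rewrite !mxE /= ?normr0 ?expr0n//.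
by rewrite addr0 expr_lt1.
Qed.

Definition axis_point t (t1 : `|t| < 1) : uball R d.+1 :=
  exist (fun z : 'rV[R[i]]_d.+1 => is_true (\sum_i `|z 0 i| ^+ 2 < 1)) _
    (axis_point_subproof t1).

Lemma cinner_axis_pointr z t (t1 : `|t| < 1) :
  cinner z (axis_point t1) = sval z 0 ord0 * t^*.
Proof.
rewrite /cinner big_ord_recl big1 ?addr0 => [|i _]; rewrite /= mxE //=.
by rewrite rmorph0 mulr0.
Qed.

Lemma axis_point0 t (t1 : `|t| < 1) : sval (axis_point t1) 0 ord0 = t.
Proof. by rewrite /= mxE. Qed.

(** Termwise, the product of two moduli is at most the mean of their squares. *)
Lemma cinner_lt1 z w : `|cinner z w| < 1.
Proof.
apply: le_lt_trans (ler_norm_sum _ _ _) _.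
have : \sum_i (`|sval z 0 i| ^+ 2 + `|sval w 0 i| ^+ 2) / 2 < (1 + 1) / 2.
  by rewrite -mulr_suml big_split /= ltr_pM2r ?invr_gt0//; apply: ltrD; [exact: (svalP z) | exact: (svalP w)].
rewrite [X in _ < X]divff ?pnatr_eq0//; apply: le_lt_trans.
apply: ler_sum => i _; rewrite normrM norm_conjC ler_pdivlMr// -subr_ge0.
have -> : `|sval z 0 i| ^+ 2 + `|sval w 0 i| ^+ 2 - `|sval z 0 i| * `|sval w 0 i| * 2
   = (`|sval z 0 i| - `|sval w 0 i|) ^+ 2 by ring.
by rewrite real_exprn_even_ge0// rpredB// normr_real.
Qed.

Lemma half_lt1 : `|2^-1 : R[i]| < 1.
Proof. by rewrite ger0_norm ?invr_ge0// invf_lt1// ltr1n. Qed.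

(** Fixing the second point at one half on the first axis and moving the first
    one along that axis, the inner products sweep out a disc, on which
    coefficients are unique. *)
Lemma ball_series_uniq (a a' : nat -> R) (f : R[i] -> R[i]) :
  (forall z w, (fun N => \sum_(0 <= n < N) (a n)%:C%C * cinner z w ^+ n : R[i]^o)
     @ \oo --> (f (cinner z w) : R[i]^o)) ->
  (forall z w, (fun N => \sum_(0 <= n < N) (a' n)%:C%C * cinner z w ^+ n : R[i]^o)
     @ \oo --> (f (cinner z w) : R[i]^o)) ->
  a =1 a'.
Proof.
have h0 : 0 < (2^-1 : R[i]) by rewrite invr_gt0.
have main (b : nat -> R) : (forall z w,
     (fun N => \sum_(0 <= n < N) (b n)%:C%C * cinner z w ^+ n : R[i]^o)
     @ \oo --> (f (cinner z w) : R[i]^o)) ->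
  power_series_on (V := R[i]^o) 2^-1 (fun n => (b n)%:C%C * 2^-1 ^+ n)
     (fun t => f (t * 2^-1)).
  move=> hb t _ tr; have t1 : `|t| < 1.
    by apply: le_lt_trans tr _; rewrite -[ltLHS]ger0_norm ?half_lt1 ?ltW.
  have := hb (axis_point t1) (axis_point half_lt1).
  rewrite cinner_axis_pointr axis_point0 fmorphV /= rmorph_nat => {}hb.
  apply: cvg_trans hb; apply: near_eq_cvg; near=> N; apply: eq_bigr => n _.
  by rewrite exprMn mulrCA.
move=> /main ha /main ha' n.
have := power_series_uniq h0 ha ha' n.
move=> /(mulIf _); rewrite expf_neq0 ?lt0r_neq0// => /(_ isT).
by case.
Unshelve. all: by end_near. Qed.

Lemma kernel_a_pow q : kernel_a (@kernel_pow R d.+1 q.+1) =1 fun j => 'C(j + q, q)%:R.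
Proof.
have cf z w : (fun N => \sum_(0 <= n < N) (('C(n + q, q)%:R : R)%:C)%C * cinner z w ^+ n : R[i]^o)
     @ \oo --> ((1 / (1 - cinner z w)) ^+ q.+1 : R[i]^o).
  have := @sum_bin_cvg R q _ (cinner_lt1 z w).
  by under eq_fun do (under eq_bigr do rewrite -(rmorph_nat (real_complex R))).
apply: (ball_series_uniq (f := fun t => (1 / (1 - t)) ^+ q.+1)) (cf).
by rewrite /kernel_a; case: xgetP => [a _ ha|/(_ _ cf)//]; exact: ha.
Qed.

(** The reciprocal of the kernel is a polynomial in the inner product, so its
    series is finite. *)
Lemma kernel_b_pow q j : (0 < j)%N ->
  kernel_b (@kernel_pow R d.+1 q.+1) j = - ((1 - 'X) ^+ q.+1 : {poly R})`_j.
Proof.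
pose P : {poly R} := (1 - 'X) ^+ q.+1.
have P0 : P`_0 = 1 by rewrite /P -horner_coef0 horner_exp hornerD hornerN hornerX hornerC subr0 expr1n.
have from0 (b : nat -> R) z w (l : R[i]) :
  (fun N => \sum_(1 <= n < N) (b n)%:C%C * cinner z w ^+ n : R[i]^o)
     @ \oo --> (l : R[i]^o) ->
  (fun N => \sum_(0 <= n < N) (if n == 0%N then 0 else b n)%:C%C * cinner z w ^+ n : R[i]^o)
     @ \oo --> (l : R[i]^o).
  apply: cvg_trans; apply: near_eq_cvg; near=> N.
  have N0 : (0 < N)%N by near: N; exists 1%N.
  rewrite [in RHS]big_ltn//= mul0r add0r; apply: eq_big_nat => i /andP[i0 _].
  by rewrite gtn_eqF.
have cf z w : (fun N => \sum_(1 <= n < N) (- P`_n)%:C%C * cinner z w ^+ n : R[i]^o)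
     @ \oo --> (1 - ((1 / (1 - cinner z w)) ^+ q.+1)^-1 : R[i]^o).
  rewrite div1r -exprVn invrK.
  apply: cvg_near_cst; near=> N.
  have N0 : (0 < N)%N by near: N; exists 1%N.
  have NP : (size P <= N)%N by near: N; exists (size P).
  have E : (map_poly (real_complex R) P).[cinner z w] = (1 - cinner z w) ^+ q.+1.
    by rewrite /P rmorphXn rmorphB /= rmorph1 map_polyX !hornerE.
  have : (size (map_poly (real_complex R) P) <= N)%N by rewrite size_map_poly.
  move=> /(@horner_coef_wide _ _ _ (cinner z w)); rewrite E => ->.
  rewrite -(big_mkord xpredT (fun i => (map_poly (real_complex R) P)`_i * cinner z w ^+ i)).
  rewrite big_ltn// expr0 mulr1 coef_map /= P0 opprD addrA subrr add0r -sumrN.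
  by apply: eq_bigr => i _; rewrite coef_map /= rmorphN mulNr.
move=> j0.
have := @ball_series_uniq
  (fun n => if n == 0%N then 0 else kernel_b (@kernel_pow R d.+1 q.+1) n)
  (fun n => if n == 0%N then 0 else - P`_n)
  (fun t => 1 - ((1 / (1 - t)) ^+ q.+1)^-1) _ _ j.
rewrite gtn_eqF//; apply => z w; last exact: from0.
apply: from0; move: z w.
by rewrite /kernel_b; case: xgetP => [b _ hb|/(_ _ cf)//]; exact: hb.
Unshelve. all: by end_near. Qed.

End KernelCoefficients.

(** * Monomials in the reproducing kernel space *)

Lemma ball_coord_lt1 (R : realType) d (z : uball R d) i : `|sval z 0 i| < 1.
Proof.
rewrite -(@expr_lt1 _ 2)//; apply: le_lt_trans (svalP z).
by rewrite (bigD1 i)//= lerDl sumr_ge0// => j _; rewrite exprn_ge0.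
Qed.

Section MonomialsInRKHS.
Variables (R : realType) (d : nat) (k : Defs.kernel R d.+1) (Hk : rkhs k).
Variable a : nat -> R.
Hypothesis k_series : forall z w,
  (fun N => \sum_(0 <= n < N) (a n)%:C%C * cinner z w ^+ n : R[i]^o)
     @ \oo --> (k z w : R[i]^o).
Implicit Types (z w : uball R d.+1) (f g : Hk).

Definition kernel_section z : Hk := sval (cid (rkhs_reproducing Hk z)).

Lemma kernel_sectionE z w : rkhs_fun (kernel_section z) w = k w z.
Proof. by rewrite /kernel_section; case: cid => kz [] /= -> _. Qed.

Lemma rkhs_eval f z : rkhs_fun f z = '[f, kernel_section z].
Proof. by rewrite /kernel_section; case: cid => kz [] /= _ ->. Qed.

(* The kernel as a function of the inner product. *)
Let F (x : R[i]) : R[i] :=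
  lim ((fun N => \sum_(0 <= n < N) (a n)%:C%C * x ^+ n : R[i]^o) @ \oo).

Let kF z w : k z w = F (cinner z w).
Proof. by rewrite /F; apply/esym; exact: (cvg_lim (@norm_hausdorff _ R[i]^o) (@k_series z w)). Qed.

(* Real points on the first axis tending to the origin. *)
Let s n : R[i] := 2^-1 ^+ n.+1.

Let s_gt0 n : 0 < s n. Proof. by rewrite exprn_gt0// invr_gt0. Qed.

Let s_lt1 n : `|s n| < 1.
Proof.
by rewrite normrX expr_lt1 ?half_lt1.
Qed.

Let sX_real n i : (s n ^+ i)^* = s n ^+ i.
Proof. by rewrite /s !rmorphXn /= fmorphV /= rmorph_nat. Qed.

Let p n := axis_point d (s_lt1 n).

Let cinner_p z n : cinner z (p n) = sval z 0 ord0 * s n.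
Proof. by rewrite cinner_axis_pointr -[X in _ * X^*]expr1 sX_real. Qed.

(* Taylor's estimate, also valid at [x = 0], where the power series lemmas say
   nothing. *)
Let F_tail j : exists2 C : R[i], 0 <= C & forall x, `|x| <= 8^-1 ->
  `|F x - \sum_(0 <= i < j.+1) (a i)%:C%C * x ^+ i| <= C * `|x| ^+ j.+1.
Proof.
pose g x := (F x - \sum_(0 <= i < j) (a i)%:C%C * x ^+ i) / x ^+ j.
have r0 : 0 < (4^-1 : R[i]) by rewrite invr_gt0.
have Fcvg x : `|x| <= 4^-1 ->
    (fun N => \sum_(0 <= n < N) (a n)%:C%C * x ^+ n : R[i]^o) @ \oo --> (F x : R[i]^o).
  move=> x4; have x2 : `|x * 2| < 1.
    rewrite normrM normr_nat -ltr_pdivlMr// mul1r; apply: le_lt_trans x4 _.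
    by rewrite ltf_pV2 ?posrE// ltr_nat.
  have E : cinner (axis_point d x2) (p 0) = x.
    by rewrite cinner_p axis_point0 /s expr1 mulfK// pnatr_eq0.
  by have := @k_series (axis_point d x2) (p 0); rewrite kF E.
have gser : power_series_on (V := R[i]^o) 4^-1 (fun n => (a (n + j)%N)%:C%C) g.
  move=> x x0 xr; have h := Fcvg x xr; rewrite -(cvg_shiftn j) in h.
  have {}h : (fun N => (\sum_(0 <= n < N + j) (a n)%:C%C * x ^+ n
      - \sum_(0 <= i < j) (a i)%:C%C * x ^+ i) * (x ^+ j)^-1 : R[i]^o) @ \oo --> (g x : R[i]^o).
    by apply: cvgM; [apply: cvgB; [exact: h | exact: cvg_cst] | exact: cvg_cst].
  apply: cvg_trans h; apply: near_eq_cvg; near=> N.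
  rewrite (@big_cat_nat _ _ _ j)//= ?leq_addl// addrAC subrr add0r.
  rewrite -{1}[j]add0n big_addn addnK mulr_suml; apply: eq_bigr => i _.
  by rewrite exprD mulrA mulfK ?expf_neq0// mulrC.
have [C C0 hC] := power_series_near0 r0 gser.
exists C => // x x8; have [->|x0] := eqVneq x 0.
  have at0 N : (0 < N)%N -> \sum_(0 <= i < N) (a i)%:C%C * 0 ^+ i = (a 0%N)%:C%C :> R[i].
    move=> N0; rewrite big_ltn// expr0 mulr1 big_nat big1 ?addr0// => i /andP[i0 _].
    by rewrite expr0n gtn_eqF// mulr0.
  have -> : F 0 = (a 0%N)%:C%C.
    apply: (cvg_lim (@norm_hausdorff _ R[i]^o)).
    apply: cvg_near_cst; near=> N; apply: at0.
    by near: N; exists 1%N.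
  by rewrite at0// subrr normr0 expr0n mulr0.
have : `|x| <= 4^-1 / 2 by rewrite -invfM -natrM.
move=> /(hC x x0); rewrite add0n => h.
have -> : F x - \sum_(0 <= i < j.+1) (a i)%:C%C * x ^+ i = x ^+ j * (g x - (a j)%:C%C).
  rewrite big_nat_recr//= /g; field; exact: expf_neq0.
by rewrite normrM normrX exprSr mulrCA ler_wpM2l// exprn_ge0.
Unshelve. all: by end_near. Qed.

(** The scaling by [a i] makes [u i] the vector that represents the functional
    taking the [i]-th Taylor coefficient along the first axis; the Gram matrix is
    then the diagonal one with entries [a i]. *)
Definition gram_of_monomials (u : nat -> Hk) j :=
  (forall i z, (i < j)%N -> rkhs_fun (u i) z = (a i)%:C%C * sval z 0 ord0 ^+ i) /\
  (forall i i', (i < j)%N -> (i' < j)%N ->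
     '[u i, u i'] = if i == i' then (a i)%:C%C else 0).

(** The next monomial is a divided difference at the origin: subtract from the
    kernel function at the axis point [s n] its Taylor polynomial of degree below
    [j], divide by [s n ^+ j], and let [n] grow. By the reproducing property the
    inner product of two such vectors is the Taylor remainder of the kernel at
    [s n * s m], divided by its leading power; it tends to [a j], so that the
    vectors form a Cauchy sequence. *)
Lemma gram_of_monomialsS u j : gram_of_monomials u j ->
  exists v, gram_of_monomials (fun i => if (i < j)%N then u i else v) j.+1.
Proof.
move=> [uE uu].
pose W n := (s n ^+ j)^-1 *: (kernel_section (p n) - \sum_(0 <= i < j) s n ^+ i *: u i).
have dotW f n : '[f, W n] = (s n ^+ j)^-1 *
    (rkhs_fun f (p n) - \sum_(0 <= i < j) s n ^+ i * '[f, u i]).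
  rewrite hdotZr fmorphV /= sX_real linearBr /= -rkhs_eval hdot_sumr.
  by congr (_ * (_ - _)); apply: eq_bigr => i _; rewrite hdotZr sX_real.
have uW i n : (i < j)%N -> '[u i, W n] = 0.
  move=> ij; rewrite dotW uE// axis_point0.
  rewrite big_mkord (bigD1 (Ordinal ij))//= uu// eqxx big1 ?addr0.
    by rewrite [_ * (a i)%:C%C]mulrC subrr mulr0.
  move=> i'; rewrite -val_eqE /= => /negbTE i'i.
  by rewrite uu// eq_sym i'i mulr0.
have Wu i n : (i < j)%N -> '[W n, u i] = 0.
  by move=> ij; rewrite hdotC uW// rmorph0.
have WE n z : rkhs_fun (W n) z = (s n ^+ j)^-1 *
    (F (sval z 0 ord0 * s n) - \sum_(0 <= i < j) (a i)%:C%C * (sval z 0 ord0 * s n) ^+ i).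
  rewrite rkhs_eval hdotZl linearBl /= -rkhs_eval kernel_sectionE hdot_suml kF cinner_p.
  congr (_ * (_ - _)); apply: eq_big_nat => i ij.
  by rewrite hdotZl -rkhs_eval uE// mulrCA [X in _ * X]mulrC exprMn.
have [C C0 hC] := F_tail j.
have s_small n : (2 <= n)%N -> s n <= 8^-1.
  move=> n2; have -> : (8^-1 : R[i]) = 2^-1 ^+ 3 by rewrite exprVn -natrX.
  by rewrite /s; apply: ler_wiXn2l; rewrite ?invr_ge0 ?invf_le1 ?ler1n.
have s_near e : 0 < e -> \forall n \near \oo, s n <= e.
  move=> /half_powers_small; apply: filterS => n; apply: le_trans.
  by rewrite /s exprS ler_piMl ?exprn_ge0 ?invr_ge0// invf_le1 ?ler1n.
have WEa n z : (2 <= n)%N ->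
    `|rkhs_fun (W n) z - (a j)%:C%C * sval z 0 ord0 ^+ j| <= C * s n * `|sval z 0 ord0| ^+ j.+1.
  move=> n2; rewrite WE; set x := sval z 0 ord0.
  have x1 : `|x| < 1 := ball_coord_lt1 z ord0.
  have := hC (x * s n); rewrite normrM (gtr0_norm (s_gt0 n)) => /(_ (le_trans _ (s_small n n2))).
  rewrite (ler_piMl (ltW (s_gt0 n)) (ltW x1)) => /(_ isT).
  rewrite big_nat_recr//= => h.
  have sj : 0 < s n ^+ j by rewrite exprn_gt0.
  have -> : (s n ^+ j)^-1 * (F (x * s n) - \sum_(0 <= i < j) (a i)%:C%C * (x * s n) ^+ i)
     - (a j)%:C%C * x ^+ j = (s n ^+ j)^-1 * (F (x * s n) -
       (\sum_(0 <= i < j) (a i)%:C%C * (x * s n) ^+ i + (a j)%:C%C * (x * s n) ^+ j)).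
    by rewrite exprMn; field; rewrite lt0r_neq0.
  rewrite normrM normfV (gtr0_norm sj) ler_pdivrMl//; apply: le_trans h _.
  by rewrite exprMn le_eqVlt; apply/orP; left; apply/eqP; rewrite [s n ^+ j.+1]exprS; ring.
have WW n m : (2 <= n)%N -> (2 <= m)%N -> `|'[W n, W m] - (a j)%:C%C| <= C * s n * s m.
  move=> n2 m2; rewrite dotW big_nat big1 ?subr0; last first.
    by move=> i /andP[_ ij]; rewrite Wu// mulr0.
  have := WEa n (p m) n2; rewrite axis_point0 (gtr0_norm (s_gt0 m)) => h.
  have sj : 0 < s m ^+ j by rewrite exprn_gt0.
  have -> : (s m ^+ j)^-1 * rkhs_fun (W n) (p m) - (a j)%:C%C =
      (s m ^+ j)^-1 * (rkhs_fun (W n) (p m) - (a j)%:C%C * s m ^+ j).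
    by field; rewrite lt0r_neq0.
  rewrite normrM normfV (gtr0_norm sj) ler_pdivrMl//; apply: le_trans h _.
  by rewrite exprSr mulrCA lexx.
have Wcvg : cvg (W @ \oo).
  apply/cauchy_cvgP/cauchy_exP => e e0.
  have D0 : 0 < 4 * (C + 1) by rewrite mulr_gt0// ltr_wpDl.
  have [N _ hN] := s_near _ (divr_gt0 e0 D0).
  exists (W (maxn N 2)).
  change (\forall n \near \oo, ball (W (maxn N 2)) e (W n)).
  near=> n; rewrite -ball_normE /ball_ /=.
  have nN : (N <= n)%N by near: n; exists N.
  have n2 : (2 <= n)%N by near: n; exists 2%N.
  set m := maxn N 2; set e' := e / (4 * (C + 1)) in hN.
  have e'0 : 0 < e' by rewrite divr_gt0.
  have sm : s m <= e' by apply: hN; rewrite /= leq_maxl.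
  have sn : s n <= e' by apply: hN.
  have m2 : (2 <= m)%N by rewrite leq_maxr.
  have bound i i' : (2 <= i)%N -> (2 <= i')%N -> s i <= e' -> s i' <= e' ->
      `|'[W i, W i'] - (a j)%:C%C| <= C * e' ^+ 2.
    move=> i2 i'2 si si'; apply: le_trans (WW _ _ i2 i'2) _.
    by rewrite -mulrA ler_wpM2l// expr2 ler_pM// ltW.
  (* All four inner products in the expansion of the square are close to [a j],
     which cancels. *)
  have : `|W m - W n| ^+ 2 <= 4 * (C * e' ^+ 2).
    rewrite -[X in X <= _]ger0_norm ?exprn_ge0// hdotE linearBl /= !linearBr /=.
    have shift (x y y' x' c : R[i]) :
      x - y - (y' - x') = (x - c) - (y - c) - ((y' - c) - (x' - c)) by ring.
    rewrite (shift _ _ _ _ (a j)%:C%C).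
    apply: le_trans (ler_normB _ _) _.
    have -> : 4 * (C * e' ^+ 2) = (C * e' ^+ 2 + C * e' ^+ 2) + (C * e' ^+ 2 + C * e' ^+ 2) by ring.
    by apply: lerD; (apply: le_trans (ler_normB _ _) _; apply: lerD; apply: bound).
  have le2 : 4 * (C * e' ^+ 2) <= (2 * (C + 1) * e') ^+ 2.
    have -> : (2 * (C + 1) * e') ^+ 2 = 4 * (C * e' ^+ 2) + 4 * (C ^+ 2 + C + 1) * e' ^+ 2 by ring.
    rewrite lerDl; apply: mulr_ge0; last by rewrite exprn_ge0// ltW.
    by rewrite mulr_ge0// !addr_ge0// exprn_ge0.
  have pos : 0 <= 2 * (C + 1) * e'.
    by apply: mulr_ge0; [rewrite mulr_ge0// addr_ge0 | exact: ltW].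
  move=> /le_trans /(_ le2); rewrite ler_sqr ?nnegrE// => /le_lt_trans; apply.
  have -> : 2 * (C + 1) * e' = e / 2 by rewrite /e'; field; rewrite lt0r_neq0// ltr_wpDl.
  by rewrite ltr_pdivrMr// ltr_pMr// ltr1n.
pose v := lim (W @ \oo).
have vE z : rkhs_fun v z = (a j)%:C%C * sval z 0 ord0 ^+ j.
  rewrite rkhs_eval.
  have h : (fun n => '[W n, kernel_section z] : R[i]^o) @ \oo -->
      ('[v, kernel_section z] : R[i]^o) by exact: cvg_hdotl.
  apply: (complex_cvg_unique h).
  apply/cvgrPdist_le => e e0.
  have C1 : 0 < C + 1 by rewrite ltr_wpDl.
  near=> n; rewrite -rkhs_eval distrC.
  have n2 : (2 <= n)%N by near: n; exists 2%N.
  apply: le_trans (WEa n z n2) _.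
  apply: (@le_trans _ _ (C * s n)).
    rewrite ler_piMr ?mulr_ge0 ?(ltW (s_gt0 n))// exprn_ile1// ltW//.
    exact: ball_coord_lt1.
  have sn : s n <= e / (C + 1) by near: n; apply: s_near; exact: divr_gt0.
  apply: (@le_trans _ _ ((C + 1) * s n)); first by rewrite ler_wpM2r ?lerDl ?ltW.
  by rewrite mulrC -ler_pdivlMr.
have vu i : (i < j)%N -> '[v, u i] = 0.
  move=> ij; have h : (fun n => '[W n, u i] : R[i]^o) @ \oo --> ('[v, u i] : R[i]^o).
    exact: cvg_hdotl.
  apply: (complex_cvg_unique h); rewrite (_ : (fun n => _) = (fun=> 0)).
    exact: cvg_cst.
  by apply/funext => n; rewrite Wu.
(* Pairing the limit with the approximants only needs the values of [v], and
   gives the norm of [v] without a further limit of remainders. *)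
have vW n : '[v, W n] = (a j)%:C%C.
  rewrite dotW vE axis_point0 big_nat big1 ?subr0; last first.
    by move=> i /andP[_ ij]; rewrite vu// mulr0.
  by rewrite mulrCA mulVf ?mulr1// expf_neq0// lt0r_neq0.
have vv : '[v, v] = (a j)%:C%C.
  have h : (fun n => '[W n, v] : R[i]^o) @ \oo --> ('[v, v] : R[i]^o).
    exact: cvg_hdotl.
  apply: (complex_cvg_unique h); rewrite (_ : (fun n => _) = (fun=> (a j)%:C%C)).
    exact: cvg_cst.
  by apply/funext => n; rewrite hdotC vW; exact: conjc_real.
exists v; split=> [i z|i i']; rewrite !ltnS.
  by rewrite leq_eqVlt => /predU1P[->|ij]; rewrite ?ltnn// ij uE.
rewrite leq_eqVlt => /predU1P[->|ij]; rewrite leq_eqVlt => /predU1P[->|i'j].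
- by rewrite ltnn eqxx vv.
- by rewrite ltnn i'j vu// gtn_eqF.
- by rewrite ltnn ij hdotC vu// ltn_eqF// rmorph0.
- by rewrite ij i'j uu.
Unshelve. all: by end_near. Qed.

Lemma rkhs_fun_eq f g : (forall z, rkhs_fun f z = rkhs_fun g z) -> f = g.
Proof. by move=> fg; apply: rkhs_fun_inj; apply/funext. Qed.

(** The squared norm of the [j]-th power of the first coordinate is the inverse
    of the kernel coefficient, and distinct powers are orthogonal. *)
Lemma rkhs_coordinate_monomials : (forall j, a j != 0) ->
  exists zeta : nat -> Hk,
    (forall j z, rkhs_fun (zeta j) z = sval z 0 ord0 ^+ j) /\
    (forall i j, '[zeta i, zeta j] = if i == j then ((a j)^-1)%:C%C else 0).
Proof.
move=> a0.
have gram j : exists u, gram_of_monomials u j.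
  elim: j => [|j [u /gram_of_monomialsS [v hv]]]; last by eexists; exact: hv.
  by exists (fun=> 0); split.
pose zeta j := ((a j)^-1)%:C%C *: sval (cid (gram j.+1)) j.
have zetaE j z : rkhs_fun (zeta j) z = sval z 0 ord0 ^+ j.
  rewrite /zeta; case: cid => u [] /= uE _.
  rewrite rkhs_eval hdotZl -rkhs_eval uE// mulrA -rmorphM /= mulVf//.
  by rewrite mul1r.
exists zeta; split=> // i j.
case: (gram (maxn i j).+1) => u [uE uu].
have zu l : (l <= maxn i j)%N -> zeta l = ((a l)^-1)%:C%C *: u l.
  move=> lm; apply: rkhs_fun_eq => z; rewrite zetaE rkhs_eval hdotZl -rkhs_eval uE//.
  by rewrite mulrA -rmorphM /= mulVf// mul1r.
rewrite !zu ?leq_maxl ?leq_maxr// hdotZl hdotZr uu ?ltnS ?leq_maxl ?leq_maxr//.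
case: eqVneq => [->|_]; last by rewrite !mulr0.
by rewrite [_^*]conjc_real -!rmorphM /= mulVf// mulr1.
Qed.

Lemma monomial_normsq_of_gram (al : mindex d.+1) (g : Hk) :
  (forall z, rkhs_fun g z = monomial al z) -> monomial_normsq Hk al = '[g, g].
Proof.
move=> gE; rewrite /monomial_normsq; case: xgetP => [f _ fE|/(_ g)[]]; last exact/funext.
by rewrite hdotE (_ : f = g)//; apply: rkhs_fun_eq => z; rewrite fE gE.
Qed.

End MonomialsInRKHS.

(** * Multi-indices supported on the first coordinate *)
Section AxisMultiIndices.
Variable d : nat.

Definition axis_index j : mindex d.+1 := [ffun i => if i == ord0 then j else 0%N].

Definition on_axis (al : mindex d.+1) := al == axis_index (al ord0).

Lemma axis_index0 j : axis_index j ord0 = j.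
Proof. by rewrite ffunE eqxx. Qed.

Lemma axis_index_inj : injective axis_index.
Proof. by move=> i j /(congr1 (fun al : mindex d.+1 => al ord0)); rewrite !axis_index0. Qed.

Lemma on_axisP al : reflect (exists j, al = axis_index j) (on_axis al).
Proof.
apply: (iffP eqP) => [->|[j ->]]; last by rewrite axis_index0.
by exists (al ord0).
Qed.

Lemma off_axis_coord al : ~~ on_axis al -> exists i : 'I_d, (0 < al (lift ord0 i))%N.
Proof.
move=> off; apply/existsP; apply: contraNT off; rewrite negb_exists => /forallP al0.
apply/eqP/ffunP => i; rewrite ffunE; case: eqP => [->//|/eqP i0].
have [i' ->] : exists i', i = lift ord0 i'.
  by move: i0; rewrite eq_sym => /unlift_some[i' -> _]; exists i'.
by have := al0 i'; rewrite -leqNgt leqn0 => /eqP.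
Qed.

Lemma mdegree_axis j : mdegree (axis_index j) = j.
Proof.
rewrite /mdegree big_ord_recl axis_index0 big1 ?addn0// => i _.
by rewrite ffunE.
Qed.

Lemma multinomial_axis j : multinomial (axis_index j) = 1%N.
Proof.
rewrite /multinomial mdegree_axis big_ord_recl axis_index0 big1 ?muln1.
  by rewrite divnn fact_gt0.
by move=> i _; rewrite ffunE.
Qed.

Lemma monomial_axis (R : realType) j (z : uball R d.+1) :
  monomial (axis_index j) z = sval z 0 ord0 ^+ j.
Proof.
rewrite /monomial big_ord_recl axis_index0 big1 ?mulr1// => i _.
by rewrite ffunE expr0.
Qed.

Lemma monomial_off_axis (R : realType) al t (t1 : `|t : R[i]| < 1) :
  ~~ on_axis al -> monomial al (axis_point d t1) = 0.
Proof.
move=> /off_axis_coord[i ali]; rewrite /monomial (bigD1 (lift ord0 i))//=.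
by rewrite mxE expr0n gtn_eqF// mul0r.
Qed.

Definition axis_fset n : {fset mindex d.+1} := seq_fset tt (map axis_index (iota 0 n)).

Lemma big_axis_fset (V : zmodType) (x : mindex d.+1 -> V) n :
  \sum_(al <- axis_fset n) x al = \sum_(0 <= j < n) x (axis_index j).
Proof.
rewrite (perm_big _ (seq_fset_perm _ _)) undup_id.
  by rewrite big_map /index_iota subn0.
by rewrite map_inj_uniq ?iota_uniq//; exact: axis_index_inj.
Qed.

Lemma in_axis_fset n j : (axis_index j \in axis_fset n) = (j < n)%N.
Proof.
by rewrite seq_fsetE mem_map ?mem_iota//; exact: axis_index_inj.
Qed.

End AxisMultiIndices.

(** * Finitely supported unordered sums *)
Section FinitelySupportedSums.
Variable I : choiceType.

Lemma partial_sum_support (V : zmodType) (x : I -> V) (A J : {fset I}) :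
  (forall i, i \notin A -> x i = 0) -> (A `<=` J)%fset ->
  partial_sum x J = \sum_(i <- A) x i.
Proof.
move=> xA AJ; rewrite /partial_sum -(big_seq_fsetE _ _ xpredT x)/=.
by apply/esym/big_fset_incl => // i _; exact: xA.
Qed.

Lemma partial_sum_support_near (V : zmodType) (x : I -> V) (A : {fset I}) :
  (forall i, i \notin A -> x i = 0) ->
  \forall J \near totally, partial_sum x J = \sum_(i <- A) x i.
Proof. by move=> xA; exists A => // J; exact: partial_sum_support. Qed.

Variables (K : numFieldType) (V : normedModType K).
Implicit Types x : I -> V.

Lemma cvg_partial_sum_support x (A : {fset I}) :
  (forall i, i \notin A -> x i = 0) ->
  partial_sum x @ totally --> \sum_(i <- A) x i.
Proof. by move=> xA; apply: cvg_near_cst; exact: partial_sum_support_near. Qed.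

Lemma sum_support x (A : {fset I}) :
  (forall i, i \notin A -> x i = 0) ->
  summability.sum x = \sum_(i <- A) x i.
Proof.
by move=> /cvg_partial_sum_support h; apply: cvg_lim => //; exact: norm_hausdorff.
Qed.

Lemma sum_single x i0 : (forall i, i != i0 -> x i = 0) -> summability.sum x = x i0.
Proof.
move=> x0; rewrite (@sum_support _ [fset i0]%fset) ?big_seq_fset1//.
by move=> i; rewrite inE; exact: x0.
Qed.

Lemma cvg_sum_single x i0 : (forall i, i != i0 -> x i = 0) ->
  partial_sum x @ totally --> x i0.
Proof.
move=> x0; have := @cvg_partial_sum_support x [fset i0]%fset.
by rewrite big_seq_fset1; apply=> i; rewrite inE; exact: x0.
Qed.

End FinitelySupportedSums.

Lemma cvg_partial_sum_axis (K : numFieldType) (V : normedModType K) d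
    (x : mindex d.+1 -> V) n :
  (forall al, ~~ on_axis al -> x al = 0) ->
  (forall j, (n <= j)%N -> x (axis_index d j) = 0) ->
  partial_sum x @ totally --> \sum_(0 <= j < n) x (axis_index d j).
Proof.
move=> off far; rewrite -big_axis_fset; apply: cvg_partial_sum_support => al.
have [/on_axisP[j ->]|/off//] := boolP (on_axis al).
by rewrite in_axis_fset -leqNgt; exact: far.
Qed.

(** * Operators, adjoints and projections *)
Section LinearMaps.
Variables (R : realType) (H K : hilbertType R) (f : H -> K).
Hypothesis fL : linear f.

Lemma linear_map0 : f 0 = 0.
Proof. by have := fL (-1) 0 0; rewrite scaler0 addr0 scaleN1r addNr. Qed.

Lemma linear_mapD x y : f (x + y) = f x + f y.
Proof. by have := fL 1 x y; rewrite !scale1r. Qed.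

Lemma linear_mapZ a x : f (a *: x) = a *: f x.
Proof. by have := fL a x 0; rewrite linear_map0 !addr0. Qed.

Lemma linear_mapB x y : f (x - y) = f x - f y.
Proof. by rewrite linear_mapD -scaleN1r linear_mapZ scaleN1r. Qed.

Lemma linear_map_sum I (r : seq I) (P : pred I) (F : I -> H) :
  f (\sum_(i <- r | P i) F i) = \sum_(i <- r | P i) f (F i).
Proof. by elim/big_rec2: _ => [|i a b _ <-]; rewrite ?linear_map0 ?linear_mapD. Qed.

End LinearMaps.

Lemma linear_iter (R : realType) (H : hilbertType R) (f : H -> H) j :
  linear f -> linear (iter j f).
Proof. by move=> fL; elim: j => [|j ih] a u v //=; rewrite ih fL. Qed.

Lemma iter_adjoint (R : realType) (H : hilbertType R) (f g : H -> H) j :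
  (forall x y, '[f x, y] = '[x, g y]) -> forall x y, '[iter j f x, y] = '[x, iter j g y].
Proof. by move=> fg; elim: j => // j ih x y; rewrite iterSr ih fg -iterS. Qed.

Lemma adjoint_unique (R : realType) (H K : hilbertType R) (f : H -> K) (g : K -> H) :
  (forall x y, '[f x, y] = '[x, g y]) -> adjoint f = g.
Proof.
move=> fg; apply: xget_unique => // g' fg'; apply/funext => y.
by apply: hdotr_inj => x; rewrite -fg -fg'.
Qed.

Section Projections.
Variables (R : realType) (H : hilbertType R) (P : H -> H).
Hypotheses (PL : linear P) (Padj : forall x y, '[P x, y] = '[x, P y])
  (PP : forall x, P (P x) = P x).

Lemma projection_dot x : '[P x, x] = `|P x| ^+ 2.
Proof. by rewrite hdotE -{1}PP Padj. Qed.

Lemma projection_contraction x : `|P x| <= `|x|.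
Proof.
rewrite -ler_sqr ?nnegrE// -subr_ge0.
have -> : `|x| ^+ 2 - `|P x| ^+ 2 = `|x - P x| ^+ 2.
  rewrite !hdotE linearBl /= !linearBr /= -(Padj x x) projection_dot hdotE.
  by rewrite subrr subr0.
exact: exprn_ge0.
Qed.

Lemma positive_projection : positive_operator P.
Proof.
split=> [|x]; last by rewrite projection_dot exprn_ge0.
by split=> //; exists 1 => x; rewrite mul1r projection_contraction.
Qed.

(** Let [B] be a positive root of the projection [P]. If [P y = y], then [B] maps
    [u = B y - y] to its opposite, and positivity forces [u = 0]; if [P y = 0],
    then [B] kills [u = B y], and positivity on the line through [y] in the
    direction [u] forces [u = 0]. So [B] agrees with [P] on its range and on its
    kernel. *)
Lemma sqrt_projection : sqrt_operator P = P.
Proof.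
apply: xget_unique; first by split; [exact: positive_projection | exact: PP].
move=> B [[[BL _] Bpos] BB]; apply/funext => x.
have PB y : B (B y) = P y by exact: BB.
have fixed y : P y = y -> B y = y.
  move=> Py; pose u := B y - y.
  have Bu : B u = - u by rewrite /u linear_mapB// PB Py opprB.
  have := Bpos u; rewrite Bu linearNl /= -hdotE oppr_ge0 => u0.
  have : `|u| ^+ 2 == 0 by rewrite eq_le u0 exprn_ge0.
  by rewrite sqrf_eq0 normr_eq0 subr_eq0 => /eqP.
have killed y : P y = 0 -> B y = 0.
  move=> Py; pose u := B y.
  have Bu : B u = 0 by rewrite /u PB.
  apply/eqP; apply: contraT => u0.
  have p0 : 0 < '[u, u] by rewrite -hdotE exprn_gt0// normr_gt0.
  (* At [y - r *: u] the quadratic form of [B] equals -1. *)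
  pose r := ('[u, y] + 1) / '[u, u].
  have r0 : 0 <= r by rewrite divr_ge0 ?(ltW p0)// addr_ge0 ?Bpos.
  have := Bpos (y - r *: u).
  rewrite linear_mapB// linear_mapZ// Bu scaler0 subr0 linearBr /= hdotZr.
  by rewrite (conj_Creal (ger0_real r0)) divfK ?lt0r_neq0// opprD addNKr oppr_ge0 ler10.
have -> : B x = B (P x) + B (x - P x).
  by rewrite -linear_mapD// addrC subrK.
by rewrite fixed// killed ?addr0// linear_mapB// PP subrr.
Qed.

End Projections.

(** * The truncated shift and its defect *)
Section TruncatedShift.
Variables (R : realType) (d : nat) (H : hilbertType R).
Variables (zeta : nat -> H) (a : nat -> R) (N : nat).
Hypothesis a_neq0 : forall j, a j != 0.
Hypothesis gram : forall i j, '[zeta i, zeta j] = if i == j then ((a j)^-1)%:C%C else 0.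
Implicit Types (h x y : H).

Let c j : R[i] := (a j)%:C%C.

Let c_conj j : (c j)^* = c j. Proof. exact: conjc_real. Qed.

Let c_gram j : c j * '[zeta j, zeta j] = 1.
Proof. by rewrite gram eqxx -rmorphM /= mulfV. Qed.

(** With [zeta j] the [j]-th power of the first coordinate, this is the compression
    of multiplication by that coordinate to the span of the powers of degree at
    most [N], extended by 0 to the orthogonal complement. The extension allows the
    ambient space to be any Hilbert space that contains the family [zeta]. *)
Definition shift h : H := \sum_(0 <= j < N) (c j * '[h, zeta j]) *: zeta j.+1.

Definition shift_adj h : H := \sum_(0 <= j < N) (c j * '[h, zeta j.+1]) *: zeta j.

(** The orthogonal projection onto the span of [zeta 1], ..., [zeta N]. *)
Definition proj_tail h : H := \sum_(1 <= j < N.+1) (c j * '[h, zeta j]) *: zeta j.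

Lemma linear_rank_one_sum m n (f g : nat -> H) (e : nat -> R[i]) :
  linear (fun h => \sum_(m <= j < n) (e j * '[h, f j]) *: g j).
Proof.
move=> t x y; rewrite scaler_sumr -big_split /=; apply: eq_bigr => j _.
by rewrite linearDl /= hdotZl scalerA -scalerDl; congr (_ *: _); ring.
Qed.

Lemma shift_linear : linear shift. Proof. exact: linear_rank_one_sum. Qed.
Lemma proj_tail_linear : linear proj_tail. Proof. exact: linear_rank_one_sum. Qed.

Lemma shift_bounded : bounded_operator shift.
Proof.
split; first exact: shift_linear.
exists (\sum_(0 <= j < N) `|c j| * `|zeta j| * `|zeta j.+1|) => h.
apply: le_trans (ler_norm_sum _ _ _) _; rewrite mulr_suml.
apply: ler_sum => j _; rewrite normrZ normrM.
have -> : `|c j| * `|zeta j| * `|zeta j.+1| * `|h| =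
   `|c j| * (`|h| * `|zeta j|) * `|zeta j.+1| by ring.
by rewrite ler_wpM2r// ler_wpM2l// hilbert_cauchy_schwarz.
Qed.

Lemma shift_adjoint x y : '[shift x, y] = '[x, shift_adj y].
Proof.
rewrite hdot_suml hdot_sumr; apply: eq_bigr => j _.
by rewrite hdotZl hdotZr rmorphM /= c_conj (hdotC (zeta j.+1)); ring.
Qed.

Lemma shift_zeta j : shift (zeta j) = if (j < N)%N then zeta j.+1 else 0.
Proof.
rewrite /shift; case: ltnP => jN.
  rewrite big_mkord (bigD1 (Ordinal jN))//= c_gram scale1r big1 ?addr0// => i.
  by rewrite -val_eqE /= eq_sym => /negbTE ij; rewrite gram ij mulr0 scale0r.
rewrite big_nat big1// => i /andP[_ iN].
by rewrite gram gtn_eqF ?mulr0 ?scale0r// (leq_trans iN).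
Qed.

Lemma iter_shift_zeta i j : (j <= N)%N ->
  iter i shift (zeta j) = if (i + j <= N)%N then zeta (i + j)%N else 0.
Proof.
move=> jN; elim: i => [|i ih] /=; first by rewrite jN.
rewrite ih -[(i.+1 + j <= N)%N]/(i + j < N)%N; case: (ltnP (i + j) N) => ijN.
  by rewrite ltnW// shift_zeta ijN.
case: ifP => _; last exact: (linear_map0 shift_linear).
by rewrite shift_zeta ltnNge ijN.
Qed.

(** Only the last of the [i.+1] applications is computed; the coefficients are
    found by moving the other ones to the right-hand side of the inner product. *)
Lemma iter_shift_adjE i h : iter i.+1 shift_adj h =
  \sum_(0 <= j < N) (c j * '[h, iter i.+1 shift (zeta j)]) *: zeta j.
Proof.
rewrite [LHS]/= /shift_adj; apply: eq_big_nat => j /andP[_ jN].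
congr (_ * _ *: _); rewrite hdotC -(iter_adjoint i shift_adjoint) -hdotC.
by rewrite iterSr shift_zeta jN.
Qed.

(** These operators are diagonal in the family [zeta]; the sum is extended to all
    [l <= N] so that the sums for different [i] can be exchanged. *)
Lemma iter_shift_shift_adj i h : (0 < i)%N ->
  iter i shift (iter i shift_adj h) =
  \sum_(0 <= l < N.+1) (if (i <= l)%N then c (l - i)%N else 0) * '[h, zeta l] *: zeta l.
Proof.
case: i => // i _; rewrite iter_shift_adjE (linear_map_sum (linear_iter _ shift_linear)).
(* The summand, in terms of the degree [l = j + i.+1] of the image. *)
pose G l := if (l <= N)%N then
  (if (i.+1 <= l)%N then c (l - i.+1)%N else 0) * '[h, zeta l] *: zeta l else 0.
transitivity (\sum_(0 <= j < N) G (j + i.+1)%N).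
  apply: eq_big_nat => j /andP[_ jN].
  rewrite (linear_mapZ (linear_iter _ shift_linear)) iter_shift_zeta ?(ltnW jN)//.
  rewrite /G [(j + i.+1)%N]addnC leq_addr addKn; case: (i.+1 + j <= N)%N => //.
  by rewrite linear0r mulr0 scale0r.
transitivity (\sum_(0 <= l < N + i.+1) G l).
  rewrite [RHS](@big_cat_nat _ _ _ i.+1)//= ?leq_addl// [X in _ = X + _]big_nat.
  rewrite [X in _ = X + _]big1 ?add0r; last first.
    by move=> l /andP[_ li]; rewrite /G [(i.+1 <= l)%N]leqNgt li mul0r scale0r; case: ifP.
  by have := @big_addn _ 0 +%R 0 (N + i.+1) i.+1 xpredT G; rewrite add0n addnK => ->.
rewrite (@big_cat_nat _ _ _ N.+1)//= ?addnS ?ltnS ?leq_addr//.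
rewrite [X in _ + X]big_nat [X in _ + X]big1 ?addr0; last first.
  by move=> l /andP[Nl _]; rewrite /G leqNgt Nl.
by apply: eq_big_nat => l /andP[_ lN]; rewrite /G -ltnS lN.
Qed.

Lemma proj_tail_adjoint x y : '[proj_tail x, y] = '[x, proj_tail y].
Proof.
rewrite hdot_suml hdot_sumr; apply: eq_bigr => j _.
by rewrite hdotZl hdotZr rmorphM /= c_conj (hdotC (zeta j)); ring.
Qed.

Lemma proj_tail_zeta j :
  proj_tail (zeta j) = if (0 < j <= N)%N then zeta j else 0.
Proof.
have E i : i != j -> (c i * '[zeta j, zeta i]) *: zeta i = 0.
  by rewrite eq_sym => /negbTE ij; rewrite gram ij mulr0 scale0r.
rewrite /proj_tail; case: ifP => [/andP[j0 jN]|jN].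
  rewrite (bigD1_seq j) ?iota_uniq ?mem_index_iota ?j0 ?ltnS//=.
  by rewrite c_gram scale1r big1 ?addr0.
rewrite big_nat big1// => i iN; apply: E; apply: contraFneq jN => <-.
by rewrite -ltnS.
Qed.

Lemma proj_tail_idem x : proj_tail (proj_tail x) = proj_tail x.
Proof.
rewrite {2}/proj_tail (linear_map_sum proj_tail_linear); apply: eq_big_nat => j jN.
by rewrite (linear_mapZ proj_tail_linear) proj_tail_zeta -ltnS jN.
Qed.

Definition coproj h := h - proj_tail h.

Lemma coproj_linear : linear coproj.
Proof.
move=> t x y; rewrite /coproj proj_tail_linear scalerBr.
by rewrite opprD addrACA.
Qed.

Lemma coproj_adjoint x y : '[coproj x, y] = '[x, coproj y].
Proof. by rewrite linearBl linearBr /= proj_tail_adjoint. Qed.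

Lemma coproj_idem x : coproj (coproj x) = coproj x.
Proof.
by rewrite {1}/coproj (linear_mapB proj_tail_linear) proj_tail_idem subrr subr0.
Qed.

Lemma coproj_zeta0 : coproj (zeta 0%N) = zeta 0%N.
Proof. by rewrite /coproj proj_tail_zeta subr0. Qed.

Lemma coproj_zetaS j : (0 < j <= N)%N -> coproj (zeta j) = 0.
Proof. by move=> jN; rewrite /coproj proj_tail_zeta jN subrr. Qed.

Hypothesis a0 : a 0%N = 1.
Hypothesis N_gt0 : (0 < N)%N.

(** The adjoint shift takes values in the span of [zeta 0], ..., [zeta N], of
    which [coproj] keeps only the direction of [zeta 0]. *)
Lemma coproj_iter_shift_adj i h : (0 < i)%N ->
  coproj (iter i shift_adj h) = '[h, iter i shift (zeta 0%N)] *: zeta 0%N.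
Proof.
case: i => // i _; rewrite iter_shift_adjE (linear_map_sum coproj_linear).
rewrite big_ltn// (linear_mapZ coproj_linear) coproj_zeta0 /c a0 mul1r.
rewrite big_nat big1 ?addr0// => j /andP[j0 jN].
by rewrite (linear_mapZ coproj_linear) coproj_zetaS ?scaler0// j0 ltnW.
Qed.

(** With 0 in all the other slots, only multi-indices on the first axis
    contribute to any of the operator sums. *)
Definition shift_tuple (i : 'I_d.+1) : H -> H := if i == ord0 then shift else fun=> 0.

Lemma shift_tuple_commuting : commuting_tuple shift_tuple.
Proof.
split=> [i|i j x]; rewrite /shift_tuple.
  case: ifP => _; first exact: shift_bounded.
  split; first by move=> t x y; rewrite scaler0 addr0.
  by exists 0 => x; rewrite normr0 mul0r.
by do 2![case: ifP => _] => //=; rewrite (linear_map0 shift_linear).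
Qed.

Lemma tuple_pow_axis j : tuple_pow shift_tuple (axis_index d j) = iter j shift.
Proof.
rewrite /tuple_pow big_ord_recl axis_index0 /shift_tuple eqxx.
rewrite (_ : \big[comp/id]_(i < d) _ = id)//.
by elim/big_rec: _ => // i f _ ->; rewrite ffunE.
Qed.

Lemma tuple_pow_off_axis al : ~~ on_axis al -> tuple_pow shift_tuple al = fun=> 0.
Proof.
move=> /off_axis_coord[i ali].
rewrite /tuple_pow big_ord_recl {1}/shift_tuple eqxx.
suff -> : \big[comp/id]_(i0 < d) iter (al (lift ord0 i0)) (shift_tuple (lift ord0 i0)) =
    fun=> 0.
  by apply/funext => x /=; rewrite (linear_map0 (linear_iter _ shift_linear)).
have kill0 n j : iter n (shift_tuple (lift ord0 j)) 0 = 0 by elim: n.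
have : i \in index_enum 'I_d by rewrite mem_index_enum.
elim: (index_enum _) => // j r ih; rewrite inE big_cons => /predU1P[<-|/ih ->].
  by apply/funext => x /=; case: (al (lift ord0 i)) ali => // n _.
by apply/funext => x /=; exact: kill0.
Qed.

Lemma tuple_pow_adj_axis j :
  tuple_pow_adj shift_tuple (axis_index d j) = iter j shift_adj.
Proof.
rewrite /tuple_pow_adj tuple_pow_axis; apply: adjoint_unique.
exact: iter_adjoint shift_adjoint.
Qed.

Lemma tuple_pow_adj_off_axis al : ~~ on_axis al ->
  tuple_pow_adj shift_tuple al = fun=> 0.
Proof.
move=> off; rewrite /tuple_pow_adj tuple_pow_off_axis//; apply: adjoint_unique => x y.
by rewrite linear0l linear0r.
Qed.

Variable k : Defs.kernel R d.+1.
Hypothesis ka : kernel_a k =1 a.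
Hypothesis kb : forall l, (0 < l)%N ->
  \sum_(1 <= i < l.+1) kernel_b k i * a (l - i)%N = a l.

Lemma kernel_ma_axis j : kernel_ma k (axis_index d j) = c j.
Proof. by rewrite /kernel_ma mdegree_axis multinomial_axis ka. Qed.

Lemma kernel_mb_axis j : (0 < j)%N -> kernel_mb k (axis_index d j) = (kernel_b k j)%:C%C.
Proof. by move=> j0; rewrite /kernel_mb mdegree_axis multinomial_axis gtn_eqF. Qed.

(** For [0 < l <= N] the sum multiplies [zeta l] by the [l]-th term of the
    convolution of the coefficients of [1 - 1 / k] and [k], divided by [a l]; this
    factor is 1 by [kb]. *)
Lemma cvg_b_summand h : partial_sum (b_summand k shift_tuple h) @ totally --> proj_tail h.
Proof.
have off al : ~~ on_axis al -> b_summand k shift_tuple h al = 0.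
  by move=> off; rewrite /b_summand tuple_pow_off_axis// scaler0.
have at0 : b_summand k shift_tuple h (axis_index d 0) = 0.
  by rewrite /b_summand /kernel_mb mdegree_axis scale0r.
have on j : (0 < j)%N -> b_summand k shift_tuple h (axis_index d j) =
    \sum_(0 <= l < N.+1) (kernel_b k j)%:C%C *:
      ((if (j <= l)%N then c (l - j)%N else 0) * '[h, zeta l] *: zeta l).
  move=> j0; rewrite /b_summand kernel_mb_axis// tuple_pow_axis tuple_pow_adj_axis.
  by rewrite iter_shift_shift_adj// scaler_sumr.
have far j : (N.+1 <= j)%N -> b_summand k shift_tuple h (axis_index d j) = 0.
  move=> Nj; rewrite on; last exact: leq_trans Nj.
  rewrite big_nat big1// => l /andP[_ lN].
  by rewrite leqNgt (leq_trans lN)// mul0r scale0r scaler0.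
have := cvg_partial_sum_axis off far.
suff -> : \sum_(0 <= j < N.+1) b_summand k shift_tuple h (axis_index d j) = proj_tail h by [].
rewrite big_ltn// at0 add0r.
under eq_big_nat => j /andP[j0 _] do rewrite on//.
rewrite exchange_big /= big_ltn// big_nat big1 ?add0r; last first.
  by move=> j /andP[j0 _]; rewrite leqNgt j0 mul0r scale0r scaler0.
apply: eq_big_nat => l /andP[l0 lN].
under eq_bigr do rewrite scalerA mulrA; rewrite -scaler_suml -mulr_suml.
congr (_ * _ *: _); rewrite /c -(kb l0) rmorph_sum /=.
rewrite (@big_cat_nat _ _ _ l.+1)//= [X in _ + X]big_nat [X in _ + X]big1 ?addr0; last first.
  by move=> j /andP[lj _]; rewrite leqNgt lj mulr0.
by apply: eq_big_nat => j /andP[_ jl]; rewrite -ltnS jl -rmorphM.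
Qed.

Lemma sum_b_summand h : summability.sum (b_summand k shift_tuple h) = proj_tail h.
Proof. exact: (cvg_lim (@norm_hausdorff _ H) (@cvg_b_summand h)). Qed.

Lemma shift_tuple_contraction : Defs.is_contraction k shift_tuple.
Proof.
split; first exact: shift_tuple_commuting.
- by move=> h; apply/cvg_ex; exists (proj_tail h); exact: cvg_b_summand.
- move=> h; rewrite sum_b_summand; apply: projection_contraction.
  + exact: proj_tail_adjoint.
  + exact: proj_tail_idem.
Qed.

Lemma shift_tuple_defect : defect k shift_tuple = coproj.
Proof.
rewrite /defect (_ : (fun h => _) = coproj).
  by apply: sqrt_projection; [exact: coproj_linear | exact: coproj_adjoint | exact: coproj_idem].
by apply/funext => h; rewrite sum_b_summand.
Qed.

Lemma V_shift_axis0 h : V_map k shift_tuple h (axis_index d 0) = coproj h.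
Proof.
by rewrite /V_map tuple_pow_adj_axis shift_tuple_defect kernel_ma_axis /c a0 scale1r.
Qed.

Lemma V_shift_axis h j : (0 < j)%N -> V_map k shift_tuple h (axis_index d j) =
  (c j * '[h, iter j shift (zeta 0%N)]) *: zeta 0%N.
Proof.
move=> j0; rewrite /V_map tuple_pow_adj_axis shift_tuple_defect kernel_ma_axis.
by rewrite coproj_iter_shift_adj// scalerA.
Qed.

Lemma zeta0_in_defect_space : defect_space k shift_tuple (zeta 0%N).
Proof.
apply: subset_closure; exists (zeta 0%N) => //.
by rewrite shift_tuple_defect coproj_zeta0.
Qed.

(** On the first axis the summand of index [j > 0] contributes the component of
    [h] along [zeta j]; the one of index 0 contributes the rest. *)
Lemma shift_tuple_pure : is_pure k shift_tuple.
Proof.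
move=> h; set x := fun al => _.
have xE al : x al = tuple_pow shift_tuple al
    (defect k shift_tuple (V_map k shift_tuple h al)).
  rewrite /x /V_map; case: (boolP (on_axis al)) => [/on_axisP[j ->]|off].
    rewrite tuple_pow_axis shift_tuple_defect (linear_mapZ coproj_linear).
    by rewrite (linear_mapZ (linear_iter _ shift_linear)).
  by rewrite tuple_pow_off_axis// scaler0.
have off al : ~~ on_axis al -> x al = 0.
  by move=> off; rewrite xE tuple_pow_off_axis.
have at0 : x (axis_index d 0) = coproj h.
  by rewrite xE tuple_pow_axis shift_tuple_defect V_shift_axis0 coproj_idem.
have on j : (0 < j)%N -> x (axis_index d j) =
    (c j * '[h, iter j shift (zeta 0%N)]) *: iter j shift (zeta 0%N).
  move=> j0; rewrite xE tuple_pow_axis shift_tuple_defect V_shift_axis//.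
  rewrite (linear_mapZ coproj_linear) coproj_zeta0.
  by rewrite (linear_mapZ (linear_iter _ shift_linear)).
have far j : (N.+1 <= j)%N -> x (axis_index d j) = 0.
  move=> Nj; rewrite on ?(leq_trans _ Nj)// iter_shift_zeta// addn0 leqNgt Nj.
  by rewrite scaler0.
have := cvg_partial_sum_axis off far.
suff -> : \sum_(0 <= j < N.+1) x (axis_index d j) = h by [].
rewrite big_ltn// at0 -[RHS](subrK (proj_tail h)); congr (_ + _).
apply: eq_big_nat => j /andP[j0 jN].
by rewrite on// iter_shift_zeta// addn0 -ltnS jN.
Qed.

End TruncatedShift.

(** * Unordered sums along the axis *)

Lemma term_le_sum (R : realType) (I : choiceType) (y : I -> R[i]) i :
  (forall i, 0 <= y i) -> cvg (partial_sum (y : I -> R[i]^o) @ totally) ->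
  y i <= summability.sum (y : I -> R[i]^o).
Proof.
move=> y0 ycvg; rewrite -subr_ge0.
have h : (fun J => partial_sum (y : I -> R[i]^o) J - y i : R[i]^o) @ totally -->
    (summability.sum (y : I -> R[i]^o) - y i : R[i]^o).
  by apply: cvgB; [exact: ycvg | exact: cvg_cst].
apply: (complex_lim_ge0 h); exists [fset i]%fset => // J /=.
rewrite fsub1set => iJ; rewrite subr_ge0 /partial_sum.
rewrite -(big_seq_fsetE _ _ xpredT y)/= (big_fsetD1 i)//= lerDl.
exact: sumr_ge0.
Qed.

(** Under geometric domination the unordered sum of a family supported on the
    axis is the ordinary series: a finite set of indices that contains the first
    [N] axis points differs from their partial sum by a geometric tail. *)
Lemma cvg_axis_sum (R : realType) (V : completeNormedModType R[i]) d
    (x : mindex d.+1 -> V) (K : R[i]) :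
  (forall al, ~~ on_axis al -> x al = 0) ->
  (forall j, `|x (axis_index d j)| <= K * 2^-1 ^+ j) ->
  (fun N => \sum_(0 <= j < N) x (axis_index d j)) @ \oo --> summability.sum x.
Proof.
move=> off xK; pose S N := \sum_(0 <= j < N) x (axis_index d j).
have K0 : 0 <= K by have := xK 0%N; rewrite mulr1; exact: le_trans.
have K1 : 0 < K * 2 + 1 by rewrite ltr_wpDl// mulr_ge0.
have small e : 0 < e -> \forall N \near \oo, K * 2 * 2^-1 ^+ N <= e.
  move=> e0; have := half_powers_small (divr_gt0 e0 K1); apply: filterS => N.
  rewrite ler_pdivlMr// => h; apply: le_trans h; rewrite mulrC.
  by rewrite ler_wpM2l ?exprn_ge0 ?invr_ge0// lerDl.
have tail N M : (N <= M)%N -> `|S N - S M| <= K * 2 * 2^-1 ^+ N.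
  move=> NM; rewrite /S [X in _ - X](@big_cat_nat _ _ _ N)//= opprD addrA subrr sub0r.
  by rewrite normrN; exact: geometric_tail.
have Scvg : cvg (S @ \oo).
  apply/cauchy_cvgP/cauchy_exP => e e0.
  have [N _ hN] := small _ (divr_gt0 e0 (ltr0n _ 2)).
  exists (S N); change (\forall n \near \oo, ball (S N) e (S n)).
  exists N => // n /= Nn; rewrite -ball_normE /ball_ /=.
  apply: le_lt_trans (tail N n Nn) _; apply: le_lt_trans (hN N (leqnn N)) _.
  by rewrite ltr_pdivrMr// ltr_pMr// ltr1n.
suff net : partial_sum x @ totally --> lim (S @ \oo).
  by rewrite (_ : summability.sum x = lim (S @ \oo))//; exact: (cvg_lim (@norm_hausdorff _ V) net).
apply/cvgrPdist_le => e e0.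
have [N _ hN] := small _ (divr_gt0 e0 (ltr0n _ 2)).
exists (axis_fset d N) => // J /= NJ; rewrite [e]splitr.
have -> : lim (S @ \oo) - partial_sum x J =
  (lim (S @ \oo) - S N) + (S N - partial_sum x J) by rewrite subrKA.
apply: le_trans (ler_normD _ _) _; apply: lerD.
  apply: (@le_normB_lim _ _ _ \oo _ S _ (S N)) => //.
  exists N => // n /= Nn; rewrite distrC; apply: le_trans (tail N n Nn) _.
  exact: hN (leqnn N).
(* Masking [x] outside of [J] turns the sum over [J] into an initial segment of
   a series with the same bound. *)
pose x' al := if al \in J then x al else 0.
pose M := maxn N (\max_(al <- J) mdegree al).+1.
have -> : partial_sum x J = \sum_(0 <= j < M) x' (axis_index d j).
  rewrite -big_axis_fset /partial_sum -(big_seq_fsetE _ _ xpredT x)/=.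
  transitivity (\sum_(al <- J) x' al).
    by rewrite big_seq [RHS]big_seq; apply: eq_bigr => al alJ; rewrite /x' alJ.
  transitivity (\sum_(al <- (axis_fset d M `|` J)%fset) x' al).
    apply: big_fset_incl; first exact: fsubsetUr.
    by move=> al _ /negbTE alJ; rewrite /x' alJ.
  symmetry; rewrite -[LHS]/(\sum_(al <- axis_fset d M) x' al).
  apply: big_fset_incl; first exact: fsubsetUl.
  move=> al _ alM; rewrite /x'; case: ifP => // alJ.
  have [/on_axisP[j alj]|/off//] := boolP (on_axis al).
  have : (mdegree al <= \max_(be <- J) mdegree be)%N by exact: leq_bigmax_seq.
  move: alM; rewrite alj in_axis_fset mdegree_axis => /negP jM jle; case: jM.
  by rewrite /M leq_max ltnS jle orbT.
rewrite (@big_cat_nat _ _ _ N)//= ?leq_maxl// opprD addrA.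
rewrite (_ : \sum_(0 <= j < N) x' (axis_index d j) = S N).
  rewrite subrr sub0r normrN; apply: le_trans (hN N (leqnn N)).
  apply: geometric_tail => j; rewrite /x'; case: ifP => // _.
  by rewrite normr0 mulr_ge0// exprn_ge0// invr_ge0.
by apply: eq_big_nat => j jN; rewrite /x' (fsubsetP NJ)// in_axis_fset; case/andP: jN.
Qed.

Definition single (I : eqType) (V : zmodType) (i0 : I) (v : V) : I -> V :=
  fun i => if i == i0 then v else 0.

(** * Coefficient families and their functions on the axis *)
Section Tensor.
Variables (R : realType) (d : nat) (k : Defs.kernel R d.+1) (Hk : rkhs k).
Variables (E : hilbertType R) (D : set E).
Implicit Types (f : mindex d.+1 -> E) (al : mindex d.+1) (v : E).

Lemma tensor_dot_singler f al v :
  tensor_dot Hk f (single al v) = monomial_normsq Hk al * '[f al, v].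
Proof.
rewrite /tensor_dot (@sum_single _ _ R[i]^o _ al) /single ?eqxx// => be /negbTE ->.
by rewrite linear0r mulr0.
Qed.

Lemma tensor_dot_singlel f al v :
  tensor_dot Hk (single al v) f = monomial_normsq Hk al * '[v, f al].
Proof.
rewrite /tensor_dot (@sum_single _ _ R[i]^o _ al) /single ?eqxx// => be /negbTE ->.
by rewrite linear0l mulr0.
Qed.

Lemma tensor_space_single al v : D 0 -> D v -> tensor_space Hk D (single al v).
Proof.
move=> D0 Dv; split=> [be|]; first by rewrite /single; case: ifP.
apply/cvg_ex; exists (monomial_normsq Hk al * `|single al v al| ^+ 2).
apply: (@cvg_sum_single _ _ R[i]^o) => be /negbTE be_al.
by rewrite /single be_al normr0 expr0n mulr0.
Qed.

Lemma tensor_fun_single al v z : tensor_fun (single al v) z = monomial al z *: v.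
Proof.
rewrite /tensor_fun (@sum_single _ _ E _ al) /single ?eqxx// => be /negbTE ->.
by rewrite scaler0.
Qed.

Lemma monomial_normsq_ge0 al : 0 <= monomial_normsq Hk al.
Proof. exact: exprn_ge0. Qed.

Lemma tensor_term_le_dot f al : tensor_space Hk D f ->
  monomial_normsq Hk al * '[f al, f al] <= tensor_dot Hk f f.
Proof.
move=> [_ fcvg].
have E1 : (fun be => monomial_normsq Hk be * '[f be, f be] : R[i]) =
    (fun be => monomial_normsq Hk be * `|f be| ^+ 2).
  by apply/funext => be; rewrite hdotE.
rewrite /tensor_dot; apply: (@term_le_sum _ _ (fun be => monomial_normsq Hk be * '[f be, f be])).
  by move=> be; rewrite -hdotE mulr_ge0 ?exprn_ge0// monomial_normsq_ge0.
by rewrite E1.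
Qed.

Variable C : R[i].
Hypothesis normsq_axis : forall j, 1 <= C * 4 ^+ j * monomial_normsq Hk (axis_index d j).

(** The norm controls each coefficient, and the weights decay at most like the
    powers of one quarter, so the coefficients grow at most like the powers of 2:
    up to modulus one quarter the series is dominated by the powers of one
    half. *)
Lemma tensor_fun_axis_series f t (t1 : `|t| < 1) : tensor_space Hk D f -> `|t| <= 4^-1 ->
  (fun N => \sum_(0 <= j < N) t ^+ j *: f (axis_index d j)) @ \oo -->
  tensor_fun f (axis_point d t1).
Proof.
move=> fD t4; pose B := tensor_dot Hk f f.
have C0 : 0 <= C.
  have := normsq_axis 0; rewrite expr0 mulr1 => h.
  have w0 : 0 < monomial_normsq Hk (axis_index d 0).
    rewrite lt0r monomial_normsq_ge0 andbT; apply: contraTneq h => ->.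
    by rewrite mulr0 ler10.
  by rewrite -(pmulr_lge0 _ w0); apply: le_trans h.
have B0 : 0 <= B.
  apply: le_trans (tensor_term_le_dot (axis_index d 0) fD).
  by rewrite -hdotE mulr_ge0 ?exprn_ge0// monomial_normsq_ge0.
(* The 1 ensures that [K ^+ 2] is at least [C * B]. *)
pose K := C * B + 1.
have fK j : `|f (axis_index d j)| <= K * 2 ^+ j.
  have K0 : 0 <= K by rewrite addr_ge0// mulr_ge0.
  rewrite -ler_sqr ?nnegrE ?mulr_ge0 ?exprn_ge0//.
  apply: (@le_trans _ _ (C * 4 ^+ j * B)).
    apply: (@le_trans _ _ (C * 4 ^+ j * monomial_normsq Hk (axis_index d j) * `|f (axis_index d j)| ^+ 2)).
      by rewrite ler_peMl ?exprn_ge0.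
    rewrite -mulrA ler_wpM2l ?mulr_ge0 ?exprn_ge0// hdotE.
    exact: tensor_term_le_dot.
  have -> : (K * 2 ^+ j) ^+ 2 = 4 ^+ j * K ^+ 2.
    rewrite (_ : 4 = 2 ^+ 2 :> R[i]); last by rewrite -natrX.
    by rewrite exprMn [RHS]mulrC; congr (_ * _); rewrite -!exprM mulnC.
  rewrite mulrAC mulrC ler_wpM2l ?exprn_ge0//.
  rewrite /K (_ : (C * B + 1) ^+ 2 = C * B + ((C * B) ^+ 2 + C * B + 1)); last by ring.
  by rewrite lerDl !addr_ge0 ?exprn_ge0 ?mulr_ge0.
have -> : (fun N => \sum_(0 <= j < N) t ^+ j *: f (axis_index d j)) =
   (fun N => \sum_(0 <= j < N) monomial (axis_index d j) (axis_point d t1) *: f (axis_index d j)).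
  by apply/funext => N; apply: eq_bigr => j _; rewrite monomial_axis axis_point0.
apply: (@cvg_axis_sum _ E _ (fun al => monomial al (axis_point d t1) *: f al) K).
  by move=> al /monomial_off_axis ->; rewrite scale0r.
move=> j; rewrite monomial_axis axis_point0 normrZ normrX.
have -> : K * 2^-1 ^+ j = 4^-1 ^+ j * (K * 2 ^+ j).
  rewrite !exprVn (_ : 4 = 2 * 2 :> R[i]); last by rewrite -natrM.
  by rewrite exprMn; field; rewrite expf_neq0.
by apply: ler_pM; rewrite ?exprn_ge0// lerXn2r// nnegrE ?invr_ge0.
Qed.

(* The function along the first axis, extended by 0 to a total function. *)
Let S f (t : R[i]) : E :=
  if pselect (`|t| < 1) is left t1 then tensor_fun f (axis_point d t1) else 0.

Let quarter_gt0 : 0 < (4^-1 : R[i]). Proof. by rewrite invr_gt0. Qed.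

Let quarter_lt1 t : `|t : R[i]| <= 4^-1 -> `|t| < 1.
Proof. by move=> /le_lt_trans; apply; rewrite invf_lt1// ltr1n. Qed.

Let S_series f : tensor_space Hk D f ->
  power_series_on 4^-1 (fun j => f (axis_index d j)) (S f).
Proof.
move=> fD t _ tr; rewrite /S; case: pselect => [t1|/(_ (quarter_lt1 tr))//].
exact: tensor_fun_axis_series.
Qed.

(** Along the axis, multiplying the function by the first coordinate shifts the
    coefficients: the identity theorem for power series in one variable. *)
Lemma tensor_fun_axis_shift f g : tensor_space Hk D f -> tensor_space Hk D g ->
  (forall t (t1 : `|t| < 1), tensor_fun g (axis_point d t1) = t *: tensor_fun f (axis_point d t1)) ->
  forall j, g (axis_index d j) = if j is j'.+1 then f (axis_index d j') else 0.
Proof.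
move=> fD gD gf.
apply: (power_series_shift quarter_gt0 (S_series fD)) => t t0 tr.
have := S_series gD t0 tr; rewrite /S; case: pselect => [t1|/(_ (quarter_lt1 tr))//].
by rewrite gf.
Qed.

Lemma tensor_fun_axis_eq0 f : tensor_space Hk D f ->
  (forall t (t1 : `|t| < 1), tensor_fun f (axis_point d t1) = 0) ->
  forall j, f (axis_index d j) = 0.
Proof.
move=> fD f0; apply: (power_series_eq0 quarter_gt0) => t t0 tr.
have := S_series fD t0 tr; rewrite /S; case: pselect => [t1|/(_ (quarter_lt1 tr))//].
by rewrite f0.
Qed.

End Tensor.

(** * The obstruction *)
Section NoCharacteristicFunction.
Variables (R : realType) (d q q' : nat).
Variables (Hm : rkhs (@kernel_pow R d.+1 q.+1)) (Hn : rkhs (@kernel_pow R d.+1 q'.+1)).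

(** The coefficients of the kernel of exponent [q.+1]. *)
Definition pow_coef (q j : nat) : R := 'C(j + q, q)%:R.

Lemma pow_coef_neq0 p j : pow_coef p j != 0.
Proof. by rewrite pnatr_eq0 -lt0n bin_gt0 leq_addl. Qed.

Lemma pow_coef0 p : pow_coef p 0 = 1.
Proof. by rewrite /pow_coef add0n binn. Qed.

Lemma kernel_pow_convolution p l : (0 < l)%N ->
  \sum_(1 <= i < l.+1) kernel_b (@kernel_pow R d.+1 p.+1) i * pow_coef p (l - i) = pow_coef p l.
Proof.
move=> l0; have := oneB_exp_convolution R p l.
rewrite (gtn_eqF l0) -(big_mkord xpredT (fun i => ((1 - 'X) ^+ p.+1 : {poly R})`_i * 'C(l - i + p, p)%:R)).
rewrite big_ltn// subn0 -horner_coef0 horner_exp hornerD hornerN hornerX hornerC subr0 expr1n mul1r.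
move=> /eqP; rewrite addr_eq0 => /eqP E; rewrite /pow_coef E -sumrN.
by apply: eq_big_nat => i /andP[i0 _]; rewrite kernel_b_pow// mulNr.
Qed.

Lemma kernel_pow_series p (z w : uball R d.+1) :
  (fun N => \sum_(0 <= n < N) (pow_coef p n)%:C%C * cinner z w ^+ n : R[i]^o)
     @ \oo --> (kernel_pow p.+1 z w : R[i]^o).
Proof.
have := @sum_bin_cvg R p _ (cinner_lt1 z w).
by under eq_fun do (under eq_bigr do rewrite -(rmorph_nat (real_complex R))).
Qed.

Lemma pow_coef_geometric p : exists C : R[i], forall j, (pow_coef p j)%:C%C <= C * 4 ^+ j.
Proof.
have h01 : 0 <= (4^-1 : R[i]) < 1 by rewrite invr_ge0 ler0n/= invf_lt1 ?ltr1n.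
exists ((1 / (1 - 4^-1)) ^+ p.+1) => j.
have := sum_bin_le p j.+1 h01; rewrite big_nat_recr//= => h.
rewrite -ler_pdivrMr ?exprn_gt0// -exprVn; apply: le_trans h.
rewrite rmorph_nat lerDr; apply: sumr_ge0 => i _.
by rewrite mulr_ge0 ?exprn_ge0// invr_ge0.
Qed.

Lemma monomial_normsq_axis p (Hp : rkhs (@kernel_pow R d.+1 p.+1)) j :
  monomial_normsq Hp (axis_index d j) = ((pow_coef p j)^-1)%:C%C.
Proof.
have [z [zE zz]] := rkhs_coordinate_monomials Hp (@kernel_pow_series p) (@pow_coef_neq0 p).
rewrite (monomial_normsq_of_gram (g := z j)) ?zz ?eqxx// => x.
by rewrite zE monomial_axis.
Qed.

(** From degree [p.+2] on, the ratio of consecutive coefficients is below 2: here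
    it is [(p.+3 + p) / p.+3]. *)
Lemma pow_coef_ratio p n : pow_coef p p.+2 * n%:R <= pow_coef p p.+3 -> (n <= 1)%N.
Proof.
rewrite /pow_coef -natrM ler_nat => h.
have E := mul_bin_down (p.+3 + p) p.
rewrite addnK in E.
have c0 : (0 < 'C(p.+2 + p, p))%N by rewrite bin_gt0 leq_addl.
have : (p.+3 * n <= p.+3 + p)%N.
  rewrite -(leq_pmul2r c0) {}E -mulnA leq_mul2l [(n * _)%N]mulnC h orbT//.
case: n {h} => [|[|n]] //; rewrite !mulnS leq_add2l => /(leq_trans (leq_addr _ _)).
by rewrite -[X in (_ <= X)%N]addn0 -addn3 leq_add2l.
Qed.

(** The truncation at [N = q.+1] puts the two relevant degrees, [N.+1] and
    [N.+2], where [pow_coef_ratio] applies. *)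
Lemma char_fun_exponent_le1 : kernel_admits_char_fun Hm Hn -> (q'.+1 <= 1)%N.
Proof.
move=> admits.
have [zeta [_ gram]] := rkhs_coordinate_monomials Hm (@kernel_pow_series q) (@pow_coef_neq0 q).
pose a := pow_coef q; pose N := q.+1.
have ka : kernel_a (@kernel_pow R d.+1 q.+1) =1 a by exact: kernel_a_pow.
have kb := @kernel_pow_convolution q.
pose T := @shift_tuple R d Hm zeta a N.
have a_neq0 := @pow_coef_neq0 q; have a0 := pow_coef0 q.
have Tcontr : Defs.is_contraction (@kernel_pow R d.+1 q.+1) T.
  exact: shift_tuple_contraction.
have Tpure : is_pure (@kernel_pow R d.+1 q.+1) T by exact: shift_tuple_pure.
have Tdefect : defect (@kernel_pow R d.+1 q.+1) T = coproj zeta a N.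
  exact: shift_tuple_defect.
have V0 h : V_map (@kernel_pow R d.+1 q.+1) T h (axis_index d 0) = coproj zeta a N h.
  exact: V_shift_axis0.
have V1 h j : (0 < j)%N -> V_map (@kernel_pow R d.+1 q.+1) T h (axis_index d j) =
    ((a j)%:C%C * '[h, iter j (shift zeta a N) (zeta 0%N)]) *: zeta 0%N.
  exact: V_shift_axis.
have Qz0 : coproj zeta a N (zeta 0%N) = zeta 0%N by exact: coproj_zeta0.
have [E [theta [M [Ms [Vs [[thetaL _] [Mmul _] MsP VsP MMs]]]]]] := admits Hm T Tcontr Tpure.
set D := defect_space _ _ in thetaL Mmul MsP VsP MMs.
have Dz : D (zeta 0%N) by exact: zeta0_in_defect_space.
have D0 : D 0.
  apply: subset_closure; exists 0 => //.
  rewrite Tdefect.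
  exact: (linear_map0 (@coproj_linear R Hm zeta a N)).
have zz : '[zeta 0%N, zeta 0%N] = 1 by rewrite gram eqxx pow_coef0 invr1.
have wm j := monomial_normsq_axis Hm j.
have wn j := monomial_normsq_axis Hn j.
pose G j : mindex d.+1 -> Hm := single (axis_index d j) (zeta 0%N).
have GD j : tensor_space Hm D (G j) by exact: tensor_space_single.
pose F j := Ms (G j).
have FE j : tensor_space Hn setT (F j) by case: (MsP _ (GD j)).
pose cf al e := M (single al e).
have sE al e : tensor_space Hn setT (single al (e : E)) by exact: tensor_space_single.
have cfD al e : tensor_space Hm D (cf al e) by case: (Mmul _ (sE al e)).
have cf_fun al e z : tensor_fun (cf al e) z = monomial al z *: theta z e.
  have [_ ->] := Mmul _ (sE al e).
  by rewrite tensor_fun_single (linear_mapZ (thetaL z).1.1).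
have aV j : (a j)%:C%C * ((pow_coef q j)^-1)%:C%C = 1 :> R[i].
  by rewrite -rmorphM /= mulfV// pow_coef_neq0.
have [C hC] := pow_coef_geometric q.
have wC j : 1 <= C * 4 ^+ j * monomial_normsq Hm (axis_index d j).
  have w0 : 0 <= ((pow_coef q j)^-1)%:C%C :> R[i] by rewrite ler0c invr_ge0 ler0n.
  by have := ler_wpM2r w0 (hC j); rewrite (aV j) wm.
have cf_off al e j : ~~ on_axis al -> cf al e (axis_index d j) = 0.
  move=> off; apply: (tensor_fun_axis_eq0 wC (cfD al e)) => t t1.
  by rewrite cf_fun monomial_off_axis// scale0r.
(* M is a multiplication operator: on the axis, the coefficients of the image of
   a monomial are shifts of those of the image of a constant. *)
have cf_shift i e j : cf (axis_index d i.+1) e (axis_index d j) =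
    if j is j'.+1 then cf (axis_index d i) e (axis_index d j') else 0.
  apply: (tensor_fun_axis_shift wC) => // t t1.
  by rewrite !cf_fun !monomial_axis axis_point0 exprS scalerA.
have cf_axis i e j : cf (axis_index d i) e (axis_index d j) =
    if (i <= j)%N then cf (axis_index d 0) e (axis_index d (j - i)) else 0.
  elim: i j => [|i ih] j; first by rewrite subn0.
  by rewrite cf_shift; case: j => // j; rewrite ih.
have adj al e j : monomial_normsq Hm (axis_index d j) * '[cf al e (axis_index d j), zeta 0%N]
   = monomial_normsq Hn al * '[e, F j al].
  rewrite -tensor_dot_singler -tensor_dot_singlel.
  by have [_ ->] := MsP _ (GD j).
pose tz j := iter j (shift zeta a N) (zeta 0%N).
have tzE j : tz j = if (j <= N)%N then zeta j else 0.
  by rewrite /tz iter_shift_zeta ?addn0.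
(* The shifts [tz j] of [zeta 0] are the images of [G j] under the adjoint of V. *)
have VsG j : Vs (G j) = tz j.
  apply: hdotr_inj => h; rewrite -VsP// tensor_dot_singler wm.
  case: j => [|j].
    rewrite V0.
    rewrite coproj_adjoint Qz0.
    by rewrite pow_coef0 invr1 mul1r.
  rewrite V1//.
  by rewrite hdotZl zz mulr1 mulrA [_ * (a _)%:C%C]mulrC aV mul1r.
(* The squared norms of the [F j] are the diagonal entries of the projection
   [I - V V*], which kills [G j] for [j <= N] and fixes it for larger [j]. *)
have FF j : tensor_dot Hn (F j) (F j) = if (j <= N)%N then 0 else ((pow_coef q j)^-1)%:C%C.
  have [_ /(_ _ (FE j)) <-] := MsP _ (GD j).
  rewrite tensor_dot_singler wm -MMs// VsG tzE {1}/G /single eqxx.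
  case: ifP => [jN|/negbT]; last rewrite -ltnNge => jN.
    suff -> : V_map (kernel_pow q.+1) T (zeta j) (axis_index d j) = zeta 0%N.
      by rewrite subrr linear0l mulr0.
    case: j jN => [|j] jN.
      rewrite V0.
      exact: Qz0.
    rewrite V1//.
    by rewrite -/(tz j.+1) tzE jN gram eqxx aV scale1r.
  rewrite V1//.
    by rewrite linear0l mulr0 scale0r subr0 zz mulr1.
  exact: leq_trans jN.
have nonneg al : 0 <= monomial_normsq Hn al by exact: exprn_ge0.
have F0 j al : (j <= N)%N -> monomial_normsq Hn al * '[F j al, F j al] = 0.
  move=> jN; apply/eqP; rewrite eq_le; apply/andP; split.
    by have := tensor_term_le_dot al (FE j); rewrite FF jN.
  by rewrite mulr_ge0// -hdotE exprn_ge0.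
have wn0 : monomial_normsq Hn (axis_index d 0) = 1 by rewrite wn pow_coef0 invr1.
have cf0 e j : (j <= N)%N -> '[cf (axis_index d 0) e (axis_index d j), zeta 0%N] = 0.
  move=> jN; have := adj (axis_index d 0) e j; rewrite wn0 mul1r.
  have := F0 j (axis_index d 0) jN; rewrite wn0 mul1r => /hdot_eq0 ->.
  rewrite linear0r wm => /eqP; rewrite mulf_eq0 => /orP[|/eqP//].
  move=> /eqP w0; have := aV j; rewrite w0 mulr0 => /eqP.
  by rewrite eq_sym oner_eq0.
(* So the adjoint of M sends [G N.+1] to a constant [f], up to weight zero. *)
have FN1 al : al != axis_index d 0 -> monomial_normsq Hn al * '[F N.+1 al, F N.+1 al] = 0.
  move=> al0; rewrite -adj.
  have [/on_axisP[i ali]|off] := boolP (on_axis al); last first.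
    by rewrite cf_off// linear0l mulr0.
  move: al0; rewrite ali (inj_eq (@axis_index_inj d)) -lt0n => i0.
  rewrite cf_axis; case: ifP => _; last by rewrite linear0l mulr0.
  by rewrite cf0 ?mulr0// leq_subLR addnC -addn1 leq_add2l.
have f0 : '[F N.+1 (axis_index d 0), F N.+1 (axis_index d 0)] = ((a N.+1)^-1)%:C%C.
  have := FF N.+1; rewrite ltnn /tensor_dot (@sum_single _ _ R[i]^o _ (axis_index d 0))//.
  by rewrite wn0 mul1r.
set f := F N.+1 (axis_index d 0) in f0; pose g := F N.+2 (axis_index d 1).
(* The linear coefficient [g] of [F N.+2] is determined by [f]. *)
have key e : monomial_normsq Hn (axis_index d 1) * '[e, g] =
    ((a N.+2)^-1)%:C%C * ((a N.+1)%:C%C * '[e, f]).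
  rewrite -adj cf_axis subn1 /= wm; congr (_ * _).
  have := adj (axis_index d 0) e N.+1; rewrite wn0 mul1r -/f => <-.
  by rewrite wm mulrA aV mul1r.
(* The part of [F N.+2] in degree one cannot exceed its whole norm. *)
have gg := tensor_term_le_dot (axis_index d 1) (FE N.+2).
rewrite -/g FF ltnNge leqnSn /= key in gg.
have fg : '[f, g] = (q'.+1%:R * (a N.+2)^-1)%:C%C.
  have := key f; rewrite f0 aV mulr1 wn /pow_coef add1n binSn rmorphM /= => <-.
  by rewrite mulrA -rmorphM /= mulfV ?pnatr_eq0// mul1r.
have a2 : 0 < a N.+2 by rewrite lt0r pow_coef_neq0 /= ler0n.
move: gg; rewrite hdotC fg [_^*]conjc_real -!rmorphM /= lecR.
rewrite ler_pdivrMl// divff ?lt0r_neq0// mulrA ler_pdivrMr// mul1r.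
exact: (@pow_coef_ratio q).
Qed.

End NoCharacteristicFunction.

Theorem theorem2p14 (R : realType) (d m n : nat)
    (d_gt0 : (0 < d)%N) (m_gt0 : (0 < m)%N) (n_gt0 : (0 < n)%N)
    (Hm : rkhs (@kernel_pow R d m)) (Hn : rkhs (@kernel_pow R d n)) :
  kernel_admits_char_fun Hm Hn -> n = 1%N.
Proof.
case: d d_gt0 m m_gt0 n n_gt0 Hm Hn => // d _ [//|q] _ [//|q'] _ Hm Hn admits.
apply/eqP; rewrite eqn_leq andbT.
exact: (char_fun_exponent_le1 admits).
Qed.
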